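(* For each standard $d\ge 2$, $\mathsf{RCA}_0^{\ast}$ proves: for all $c\ge 1$ and all $m\ge d$, $$wr^d_{kc}(m)\ge T_{d-2}\bigl(m^{c}\bigr),\qquad\text{where }k=5^{d-2}.$$
   Context: $\mathsf{RCA}_0^{\ast}$ is the subsystem of second order arithmetic, in the usual language augmented by a binary function symbol $\exp$ (written $m^n$), whose axioms are: the basic axioms of second order arithmetic (the usual quantifier-free axioms for $0,1,+,\cdot,<$); the exponentiation axioms $m^0=1$, $m^{n+1}=m\cdot m^n$; the induction scheme for all $\Sigma^0_0$ formulas (possibly containing $\exp$); and the comprehension scheme for all $\Delta^0_1$ formulas (possibly containing $\exp$). $\mathbb{N}$ is the set of nonnegative integers, and a number $c\in\mathbb{N}$ of colors is identified with $\{0,\dots,c-1\}$. $[0,R]=\{n\in\mathbb{N}:n\le R\}$ and $[0,R]^d=\{(x_0,\dots,x_{d-1})\in\mathbb{N}^d:0\le x_0<\cdots<x_{d-1}\le R\}$. For a coloring $C\colon[0,R]^d\to c$, a set $H=\{h_0<h_1<\cdots\}\subseteq[0,R]$ is $C$-weakly homogeneous if $C(h_i,\dots,h_{i+d-1})=C(h_{i+1},\dots,h_{i+d})$ for all $h_i,h_{i+1},\dots,h_{i+d}$ in $H$. $wr^d_c(m)$ is the smallest $R$ such that for every coloring $C\colon[0,R]^d\to c$ there exists a $C$-weakly homogeneous set of size $m+1$. $T_n$ is the exponential tower with $n$ twos: $T_0(x)=x$ and $T_{n+1}(x)=2^{T_n(x)}$. Standard $d$ means an actual natural number of the metatheory.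 *)

(* Defs.v *)
From Stdlib Require List.
From mathcomp Require Import all_boot.

Set Implicit Arguments.
Unset Strict Implicit.
Unset Printing Implicit Defensive.

(** * The language of second order arithmetic with exponentiation *)

(* Both sorts use de Bruijn indices, numbered independently of each other: a
   number quantifier shifts only number variables, a set quantifier only set
   variables. *)

Inductive term : Type :=
| Var of nat
| Zero
| One
| Add of term & term
| Mul of term & term
| Exp of term & term.

(* The logic is classical; the other connectives are abbreviations. *)
Inductive form : Type :=
| Eq of term & term
| Lt of term & term
| In of term & nat
| Bot
| Imp of form & form
| All of form
| AllS of form.

Definition Not (A : form) : form := Imp A Bot.
Definition And (A B : form) : form := Not (Imp A (Not B)).
Definition Or (A B : form) : form := Imp (Not A) B.
Definition Iff (A B : form) : form := And (Imp A B) (Imp B A).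
Definition Ex (A : form) : form := Not (All (Not A)).
Definition ExS (A : form) : form := Not (AllS (Not A)).
Definition Le (s t : term) : form := Or (Lt s t) (Eq s t).

Declare Scope l2_scope.
Delimit Scope l2_scope with L2.
Notation "$ n" := (Var n) (at level 8, n at level 2, format "$ n") : l2_scope.
Notation "s +' t" := (Add s t) (at level 50, left associativity) : l2_scope.
Notation "s *' t" := (Mul s t) (at level 40, left associativity) : l2_scope.
Notation "s ^^' t" := (Exp s t) (at level 30, right associativity) : l2_scope.
Notation "s =' t" := (Eq s t) (at level 70, no associativity) : l2_scope.
Notation "s <' t" := (Lt s t) (at level 70, no associativity) : l2_scope.
Notation "s <=' t" := (Le s t) (at level 70, no associativity) : l2_scope.
Notation "t \in' X" := (In t X) (at level 70, no associativity) : l2_scope.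
Notation "~' A" := (Not A) (at level 75, right associativity) : l2_scope.
Notation "A /\' B" := (And A B) (at level 80, right associativity) : l2_scope.
Notation "A \/' B" := (Or A B) (at level 85, right associativity) : l2_scope.
Notation "A ->' B" := (Imp A B) (at level 90, right associativity) : l2_scope.
Notation "A <->' B" := (Iff A B) (at level 95, no associativity) : l2_scope.
Local Open Scope l2_scope.

(** * Substitution *)

Fixpoint tsubst (f : nat -> term) (t : term) : term :=
  match t with
  | Var n => f n
  | Zero => Zero
  | One => One
  | Add s t => Add (tsubst f s) (tsubst f t)
  | Mul s t => Mul (tsubst f s) (tsubst f t)
  | Exp s t => Exp (tsubst f s) (tsubst f t)
  end.

(* [tlift n t] is [t] read under [n] additional number quantifiers. *)
Definition tlift (n : nat) (t : term) : term := tsubst (fun i => $(n + i)) t.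

Definition up (f : nat -> term) (n : nat) : term :=
  if n is p.+1 then tlift 1 (f p) else $0.

Definition upS (g : nat -> nat) (n : nat) : nat :=
  if n is p.+1 then (g p).+1 else 0.

(* Simultaneous substitution of terms for number variables and renaming of set
   variables (the set sort has no terms other than variables). *)
Fixpoint subst (f : nat -> term) (g : nat -> nat) (A : form) : form :=
  match A with
  | Eq s t => Eq (tsubst f s) (tsubst f t)
  | Lt s t => Lt (tsubst f s) (tsubst f t)
  | In t X => In (tsubst f t) (g X)
  | Bot => Bot
  | Imp A B => Imp (subst f g A) (subst f g B)
  | All A => All (subst (up f) g A)
  | AllS A => AllS (subst f (upS g) A)
  end.

Definition shift : form -> form := subst (fun n => $n.+1) id.
Definition shiftS : form -> form := subst Var S.

Definition inst (t : term) : form -> form :=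
  subst (fun n => if n is p.+1 then $p else t) id.
Definition instS (X : nat) : form -> form :=
  subst Var (fun n => if n is p.+1 then p else X).

(** * The axioms of RCA_0^* *)

(* In [s0_ball] and [s0_bex] the bound [t] is lifted, hence does not contain
   the quantified variable. *)
Inductive Sigma00 : form -> Prop :=
| s0_eq s t : Sigma00 (s =' t)
| s0_lt s t : Sigma00 (s <' t)
| s0_in t X : Sigma00 (t \in' X)
| s0_bot : Sigma00 Bot
| s0_imp A B : Sigma00 A -> Sigma00 B -> Sigma00 (A ->' B)
| s0_ball t A : Sigma00 A -> Sigma00 (All ($0 <' tlift 1 t ->' A))
| s0_bex t A : Sigma00 A -> Sigma00 (Ex ($0 <' tlift 1 t /\' A)).

Inductive Sigma01 : form -> Prop :=
| Sigma01_intro A : Sigma00 A -> Sigma01 (Ex A).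

Inductive Pi01 : form -> Prop :=
| Pi01_intro A : Sigma00 A -> Pi01 (All A).

(* Free variables in the axioms are parameters, read as universally
   quantified. *)
Inductive RCA0star : form -> Prop :=
| ax_succ_neq0 : RCA0star (~' ($0 +' One =' Zero))
| ax_succ_inj : RCA0star ($0 +' One =' $1 +' One ->' $0 =' $1)
| ax_add0 : RCA0star ($0 +' Zero =' $0)
| ax_addS : RCA0star ($0 +' ($1 +' One) =' ($0 +' $1) +' One)
| ax_mul0 : RCA0star ($0 *' Zero =' Zero)
| ax_mulS : RCA0star ($0 *' ($1 +' One) =' $0 *' $1 +' $0)
| ax_lt0 : RCA0star (~' ($0 <' Zero))
| ax_ltS : RCA0star ($0 <' $1 +' One <->' ($0 <' $1 \/' $0 =' $1))
| ax_exp0 : RCA0star ($0 ^^' Zero =' One)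
| ax_expS : RCA0star ($0 ^^' ($1 +' One) =' $0 *' $0 ^^' $1)
| ax_induction A : Sigma00 A ->
    RCA0star
      (inst Zero A /\'
       All (A ->' subst (fun n => if n is p.+1 then $p.+1 else $0 +' One) id A)
       ->' All A)
| ax_comprehension A B : Sigma01 A -> Pi01 B ->
    RCA0star (All (A <->' B) ->' ExS (All ($0 \in' 0 <->' shiftS A))).

(** * Derivability: classical natural deduction with equality *)

Inductive derivable (T : form -> Prop) : seq form -> form -> Prop :=
| d_axiom (G : seq form) (A : form) : T A -> derivable T G A
| d_hyp (G : seq form) (A : form) : List.In A G -> derivable T G A
| d_impI (G : seq form) (A B : form) :
    derivable T (A :: G) B -> derivable T G (A ->' B)
| d_impE (G : seq form) (A B : form) :
    derivable T G (A ->' B) -> derivable T G A -> derivable T G B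
| d_raa (G : seq form) (A : form) :
    derivable T ((~' A) :: G) Bot -> derivable T G A
| d_allI (G : seq form) (A : form) :
    derivable T (map shift G) A -> derivable T G (All A)
| d_allE (G : seq form) (A : form) (t : term) :
    derivable T G (All A) -> derivable T G (inst t A)
| d_allSI (G : seq form) (A : form) :
    derivable T (map shiftS G) A -> derivable T G (AllS A)
| d_allSE (G : seq form) (A : form) (X : nat) :
    derivable T G (AllS A) -> derivable T G (instS X A)
| d_refl (G : seq form) (t : term) : derivable T G (t =' t)
| d_leibniz (G : seq form) (A : form) (s t : term) :
    derivable T G (s =' t) -> derivable T G (inst s A) ->
    derivable T G (inst t A).

Definition proves (T : form -> Prop) (A : form) : Prop := derivable T [::] A.

(** * Weakly homogeneous sets inside second order arithmetic *)

Fixpoint num (n : nat) : term := if n is p.+1 then num p +' One else Zero.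

Fixpoint tower (n : nat) (t : term) : term :=
  if n is p.+1 then num 2 ^^' tower p t else t.

Definition Alls (n : nat) (A : form) : form := iter n All A.
Definition Exs (n : nat) (A : form) : form := iter n Ex A.
Definition Conj (As : seq form) : form := foldr And (Not Bot) As.

(* The usual pairing map (x, y) |-> (x + y)^2 + x of second order arithmetic;
   an n-tuple is a left-nested pair. *)
Definition tpair (s t : term) : term := (s +' t) *' (s +' t) +' s.
Definition ttuple (ts : seq term) : term :=
  if ts is t :: ts' then foldl tpair t ts' else Zero.

(* The set F is (the graph of) a function from A to B. Subsets of the numbers
   are given as [A n t], meaning "t belongs to A", where [t] lives under [n]
   number quantifiers more than the parameters of A. *)
Definition is_function (F : nat) (A B : nat -> term -> form) : form :=
  All ($0 \in' F ->' Ex (Ex (A 3 $1 /\' B 3 $0 /\' $2 =' tpair $1 $0))) /\'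
  All (A 1 $0 ->'
       Ex (B 2 $0 /\' tpair $1 $0 \in' F /\'
           All (B 3 $0 /\' tpair $2 $0 \in' F ->' $0 =' $1))).

(* a codes (x_0, ..., x_(d-1)) with x_0 < ... < x_(d-1) <= r, for d > 0; the
   variable x_j is $j. *)
Definition increasing_tuple (d : nat) (r a : term) : form :=
  Exs d (Conj [seq $j <' $j.+1 | j <- iota 0 d.-1] /\'
         $d.-1 <=' tlift d r /\'
         tlift d a =' ttuple [seq $j | j <- iota 0 d]).

(* C is a map [0,r]^d -> {0, ..., c-1}. *)
Definition coloring (C d : nat) (r c : term) : form :=
  is_function C (fun n a => increasing_tuple d (tlift n r) a)
                (fun n v => v <' tlift n c).

(* h is the increasing enumeration i |-> h_i, 0 <= i <= m, of the set H; in
   particular H has size m + 1. *)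
Definition enumeration (h H : nat) (m : term) : form :=
  is_function h (fun n i => i <=' tlift n m) (fun n x => x \in' H) /\'
  All (All (All (All (tpair $3 $1 \in' h /\' tpair $2 $0 \in' h /\' $3 <' $2
                      ->' $1 <' $0)))) /\'
  All ($0 \in' H ->' Ex (tpair $0 $1 \in' h)).

(* With $(d+1) for i and $j for x_j: if h_i = x_0, ..., h_(i+d) = x_d then
   C(x_0, ..., x_(d-1)) = C(x_1, ..., x_d). *)
Definition weakly_homogeneous (C h d : nat) : form :=
  All (Alls d.+1
    (Conj [seq tpair ($d.+1 +' num j) $j \in' h | j <- iota 0 d.+1] ->'
     Ex (tpair (ttuple [seq $j.+1 | j <- iota 0 d]) $0 \in' C /\'
         tpair (ttuple [seq $j.+1 | j <- iota 1 d]) $0 \in' C))).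

(* Every C : [0,r]^d -> c has a C-weakly homogeneous set H, contained in [0,r],
   of size m + 1. Here C, H and h are the set variables 2, 1 and 0 under the
   three set quantifiers. *)
Definition weak_ramsey (d : nat) (c m r : term) : form :=
  AllS (coloring 0 d r c ->'
    ExS (ExS (All ($0 \in' 1 ->' $0 <=' tlift 1 r) /\'
              enumeration 0 1 m /\'
              weakly_homogeneous 2 0 d))).

(* wr^d_c(m) >= t, where wr^d_c(m) is the smallest r with [weak_ramsey d c m r]:
   no number below t has this property. In particular t is a lower bound even
   in a theory that does not prove wr^d_c total. *)
Definition wr_ge (d : nat) (c m t : term) : form :=
  All (weak_ramsey d (tlift 1 c) (tlift 1 m) $0 ->' tlift 1 t <=' $0).

(* Main.v *)
(* By Goedel's completeness theorem for the given calculus it suffices to argue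
   in an arbitrary model M of RCA_0^*. Sets and functions of M defined by bounded
   formulas with parameters are available for induction and comprehension.

   Write j = d - 2 and m = p + j with p >= 2. For d = 2, color x < y below p^K by
   the highest position at which their base-p digits differ; that digit strictly
   increases along a sequence with constant color, so such a sequence has at most
   p elements. To pass from F on d-tuples below n to (d+1)-tuples below 2^n, let
   delta_i be the highest bit at which x_i and x_(i+1) differ; neighbouring
   delta_i are distinct. Increasing and decreasing windows of deltas are colored
   by F in two disjoint palettes. For d >= 3 the remaining windows need four
   extra colors, chosen so that no two consecutive windows share one. Then the
   deltas of a weakly homogeneous sequence are monotone and weakly homogeneous
   for F, at the cost of one element per step.

   The lost elements are recovered at the bottom: starting with (j+1)c colors
   gives p^((j+1)c) >= (p+j)^c = m^c, and K |-> 2K, K |-> 2K + 4, ... leads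
   to at most 5^j c colors. *)

Require Import Defs.
From Stdlib Require List.
From Stdlib Require Import Classical ClassicalEpsilon FunctionalExtensionality.
From Stdlib Require Import PropExtensionality ProofIrrelevance.
From Stdlib Require Import Ring.
From mathcomp Require Import all_boot.
From mathcomp Require Import zify.

Set Implicit Arguments.
Unset Strict Implicit.
Unset Printing Implicit Defensive.

Local Open Scope l2_scope.

(** * Substitution calculus *)

(** The theory has induction only for bounded formulas and no primitive recursion, so colorings and
    sequences are never built by recursion inside the model. Each function is carried with a
    definable graph and a bound by a term, and the stepping-up is iterated in the metatheory, which
    is where the standardness of $d$ enters.

    Neighbouring deltas are distinct because, with all higher bits fixed, a bit can rise from 0 to 1
    only once along an increasing sequence. A mixed window offers no monotone tuple to F, so its
    color only has to make a shift by one place visible: the first comparison together with the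
    parity of its run does this with four values. When F lives on pairs, a window has a single
    comparison and cannot be mixed, so no extra colors are spent.

    The lost elements are repaired at the bottom because there the number of colors is an exponent:
    multiplying it by $j+1$ replaces the base $p$ by $p^{j+1}\ge p+j$, whereas the later steps leave
    the argument of the tower untouched. *)

Definition scons {X : Type} (x : X) (e : nat -> X) (n : nat) : X :=
  if n is p.+1 then e p else x.
Notation "x .: e" := (scons x e) (at level 55, e at level 55, right associativity).

Lemma scons_eta X (e : nat -> X) : e 0 .: (fun n => e n.+1) = e.
Proof. by apply: functional_extensionality => -[]. Qed.

Lemma tsubst_comp f g t :
  tsubst f (tsubst g t) = tsubst (fun n => tsubst f (g n)) t.
Proof. by elim: t => //= s -> t ->. Qed.

Lemma tsubst_id t : tsubst Var t = t.
Proof. by elim: t => //= s -> t ->. Qed.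

Lemma up_comp f g :
  (fun n => tsubst (up f) (up g n)) = up (fun n => tsubst f (g n)).
Proof.
apply: functional_extensionality => -[|n] //=.
by rewrite /tlift !tsubst_comp.
Qed.

Lemma up_Var : up Var = Var.
Proof. by apply: functional_extensionality => -[]. Qed.

Lemma upS_id : upS id = id.
Proof. by apply: functional_extensionality => -[]. Qed.

Lemma upS_comp g g' : (fun n => upS g (upS g' n)) = upS (fun n => g (g' n)).
Proof. by apply: functional_extensionality => -[]. Qed.

Lemma subst_comp f g f' g' A :
  subst f g (subst f' g' A) =
  subst (fun n => tsubst f (f' n)) (fun n => g (g' n)) A.
Proof.
elim: A f g f' g' => //=.
- by move=> s t *; rewrite !tsubst_comp.
- by move=> s t *; rewrite !tsubst_comp.
- by move=> t X *; rewrite tsubst_comp.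
- by move=> A IHA B IHB f g f' g'; rewrite IHA IHB.
- by move=> A IHA f g f' g'; rewrite IHA up_comp.
- by move=> A IHA f g f' g'; rewrite IHA upS_comp.
Qed.

Lemma subst_id A : subst Var id A = A.
Proof.
elim: A => //=.
- by move=> s t; rewrite !tsubst_id.
- by move=> s t; rewrite !tsubst_id.
- by move=> t X; rewrite !tsubst_id.
- by move=> A -> B ->.
- by move=> A IHA; rewrite up_Var IHA.
- by move=> A IHA; rewrite upS_id IHA.
Qed.

Lemma instE t : inst t = subst (t .: Var) id.
Proof. by []. Qed.

Lemma instSE X : instS X = subst Var (X .: id).
Proof. by []. Qed.

Lemma inst_subst_up t f g A :
  inst t (subst (up f) g A) = subst (t .: f) g A.
Proof.
rewrite instE subst_comp; congr subst; apply: functional_extensionality => -[|n] //=.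
by rewrite /tlift tsubst_comp /= tsubst_id.
Qed.

Lemma instS_subst_upS X f g A :
  instS X (subst f (upS g) A) = subst f (X .: g) A.
Proof.
rewrite instSE subst_comp; congr subst; apply: functional_extensionality.
  by move=> n; rewrite tsubst_id.
by case.
Qed.

Lemma subst_inst f g t A : subst f g (inst t A) = subst (tsubst f t .: f) g A.
Proof.
by rewrite instE subst_comp; congr subst; apply: functional_extensionality => -[].
Qed.

Lemma subst_instS f g X A : subst f g (instS X A) = subst f (g X .: g) A.
Proof.
by rewrite instSE subst_comp; congr subst; apply: functional_extensionality => -[].
Qed.

Lemma subst_shift f g A : subst (up f) g (shift A) = shift (subst f g A).
Proof. by rewrite /shift !subst_comp. Qed.

Lemma subst_shiftS f g A : subst f (upS g) (shiftS A) = shiftS (subst f g A).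
Proof.
rewrite /shiftS !subst_comp; congr subst.
by apply: functional_extensionality => n; rewrite tsubst_id.
Qed.

(* Strict upper bounds for the free variables. *)
Fixpoint tbound (t : term) : nat :=
  match t with
  | Var n => n.+1
  | Zero | One => 0
  | Add s t | Mul s t | Exp s t => maxn (tbound s) (tbound t)
  end.

Fixpoint bound (A : form) : nat :=
  match A with
  | Eq s t | Lt s t => maxn (tbound s) (tbound t)
  | In t _ => tbound t
  | Bot => 0
  | Imp A B => maxn (bound A) (bound B)
  | All A => (bound A).-1
  | AllS A => bound A
  end.

Fixpoint boundS (A : form) : nat :=
  match A with
  | Eq _ _ | Lt _ _ | Bot => 0
  | In _ X => X.+1
  | Imp A B => maxn (boundS A) (boundS B)
  | All A => boundS A
  | AllS A => (boundS A).-1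
  end.

Lemma tsubst_bound f f' t :
  (forall i, i < tbound t -> f i = f' i) -> tsubst f t = tsubst f' t.
Proof.
elim: t => //= [n -> //|s IHs t IHt H|s IHs t IHt H|s IHs t IHt H];
by rewrite IHs ?IHt // => i Hi; apply: H; rewrite leq_max Hi ?orbT.
Qed.

Lemma subst_bound f g f' g' A :
  (forall i, i < bound A -> f i = f' i) ->
  (forall i, i < boundS A -> g i = g' i) -> subst f g A = subst f' g' A.
Proof.
elim: A f g f' g' => //=.
- by move=> s t f g f' g' H _; rewrite !(@tsubst_bound f f') // => i Hi;
    apply: H; rewrite leq_max Hi ?orbT.
- by move=> s t f g f' g' H _; rewrite !(@tsubst_bound f f') // => i Hi;
    apply: H; rewrite leq_max Hi ?orbT.
- by move=> t X f g f' g' H HS; rewrite (tsubst_bound H) HS.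
- move=> A IHA B IHB f g f' g' H HS; rewrite (IHA f g f' g') ?(IHB f g f' g') //;
  by move=> i Hi; (apply: H || apply: HS); rewrite leq_max Hi ?orbT.
- move=> A IHA f g f' g' H HS; congr All; apply: IHA => // -[|i] //= Hi.
  by rewrite H //; case: (bound A) Hi.
- move=> A IHA f g f' g' H HS; congr AllS; apply: IHA => // -[|i] //= Hi.
  by rewrite HS //; case: (boundS A) Hi.
Qed.

(** * Derivations are closed under substitution *)

Section Derivations.
Variable T : form -> Prop.

Lemma weakening G G' A :
  derivable T G A -> (forall B, List.In B G -> List.In B G') -> derivable T G' A.
Proof.
move=> D; elim: D G' => {G A}.
- by move=> G A TA G' _; apply: d_axiom.
- by move=> G A GA G' sub; apply: d_hyp; apply: sub.
- move=> G A B _ IH G' sub; apply: d_impI; apply: IH => C /= [->|]; first by left.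
  by move/sub; right.
- by move=> G A B _ IH1 _ IH2 G' sub; apply: d_impE (IH1 _ sub) (IH2 _ sub).
- move=> G A _ IH G' sub; apply: d_raa; apply: IH => C /= [->|]; first by left.
  by move/sub; right.
- move=> G A _ IH G' sub; apply: d_allI; apply: IH => C.
  by rewrite !List.in_map_iff => -[B [<- /sub HB]]; exists B.
- by move=> G A t _ IH G' sub; apply: d_allE; apply: IH.
- move=> G A _ IH G' sub; apply: d_allSI; apply: IH => C.
  by rewrite !List.in_map_iff => -[B [<- /sub HB]]; exists B.
- by move=> G A t _ IH G' sub; apply: d_allSE; apply: IH.
- by move=> *; apply: d_refl.
- by move=> G A s t _ IH1 _ IH2 G' sub; apply: d_leibniz (IH1 _ sub) (IH2 _ sub).
Qed.

(** In [iter n All A] the outermost quantifier binds the largest index, so instantiation starts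
    there, and every [f i] is read in the outer context. *)
Lemma derivable_Alls_inst n f G A :
  derivable T G (iter n All A) ->
  derivable T G (subst (fun i => if i < n then f i else $(i - n)) id A).
Proof.
elim: n A => [|n IHn] A /=.
  suff -> : (fun i => if i < 0 then f i else $(i - 0)) = Var by rewrite subst_id.
  by apply: functional_extensionality => i; rewrite subn0.
move=> /(d_allE (f n)).
have iter_subst k h B : subst h id (iter k All B) = iter k All (subst (iter k up h) id B).
  by elim: k h => // k IHk h; rewrite [in LHS]/= IHk -iterSr.
have iter_up k t i : iter k up (t .: Var) i =
    if i < k then $i else if i == k then tlift k t else $i.-1.
  elim: k i => [|k IHk] [|i] //=; first by rewrite /tlift tsubst_id.
  rewrite IHk ltnS eqSS; case: ifP => // ik; case: ifP => [_|/negbT/eqP ne].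
    by rewrite /tlift tsubst_comp.
  by case: i k {IHk} ik ne => [|i] [|k].
rewrite instE iter_subst => /IHn; rewrite subst_comp.
set h := (fun i => tsubst _ _); set h' := (fun i => if _ then _ else _).
suff -> : h = h' by [].
apply: functional_extensionality => i; rewrite /h /h' iter_up.
case: (ltngtP i n) => [lt|gt|->] /=.
- by rewrite lt ltnS ltnW.
- have i_gt0 : 0 < i by apply: leq_ltn_trans gt.
  have -> : (i.-1 < n) = false by apply/negbTE; rewrite -leqNgt -ltnS prednK.
  have -> : (i < n.+1) = false by apply/negbTE; rewrite -leqNgt.
  by case: i gt i_gt0 => // i _ _; rewrite subSS.
- rewrite ltnS leqnn /tlift tsubst_comp -[RHS]tsubst_id; apply: tsubst_bound.
  by move=> j _ /=; rewrite ltnNge leq_addr /= addKn.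
Qed.

Lemma derivable_AllSs_inst n g G A :
  derivable T G (iter n AllS A) ->
  derivable T G (subst Var (fun i => if i < n then g i else i - n) A).
Proof.
elim: n A => [|n IHn] A /=.
  suff -> : (fun i => if i < 0 then g i else i - 0) = id by rewrite subst_id.
  by apply: functional_extensionality => i; rewrite subn0.
move=> /(d_allSE (g n)).
have iter_subst k h B : subst Var h (iter k AllS B) = iter k AllS (subst Var (iter k upS h) B).
  by elim: k h => // k IHk h; rewrite [in LHS]/= IHk -iterSr.
have iter_up k x i : iter k upS (x .: id) i =
    if i < k then i else if i == k then k + x else i.-1.
  elim: k i => [|k IHk] [|i] //=.
  rewrite IHk ltnS eqSS; case: ifP => // ik; case: ifP => [_|/negbT/eqP ne] //.
  by case: i k {IHk} ik ne => [|i] [|k].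
rewrite instSE iter_subst => /IHn; rewrite subst_comp.
set h := (fun i => if _ then _ else _); set h' := (fun i => if _ then _ else _).
suff -> : h = h' by [].
apply: functional_extensionality => i; rewrite /h /h' iter_up.
case: (ltngtP i n) => [lt|gt|->] /=.
- by rewrite lt ltnS ltnW.
- have i_gt0 : 0 < i by apply: leq_ltn_trans gt.
  have -> : (i.-1 < n) = false by apply/negbTE; rewrite -leqNgt -ltnS prednK.
  have -> : (i < n.+1) = false by apply/negbTE; rewrite -leqNgt.
  by case: i gt i_gt0 => // i _ _; rewrite subSS.
- by rewrite ltnS leqnn ltnNge leq_addr /= addKn.
Qed.

(** Axioms are open formulas whose instances need not be axioms again. But an axiom is available in
    every context, so it can be closed under quantifiers of both sorts and then instantiated. *)
Lemma axiom_subst G A f g : T A -> derivable T G (subst f g A).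
Proof.
move=> TA.
have all_axiom n H : derivable T H (iter n All A).
  by elim: n H => [|n IHn] H; [apply: d_axiom | apply: d_allI; apply: IHn].
have allS_axiom k n H : derivable T H (iter k AllS (iter n All A)).
  by elim: k H => [|k IHk] H; [apply: all_axiom | apply: d_allSI; apply: IHk].
have /derivable_AllSs_inst-/(_ g) := allS_axiom (boundS A) (bound A) G.
set g' := fun i => _.
have -> : subst Var g' (iter (bound A) All A) = iter (bound A) All (subst Var g' A).
  by elim: (bound A) => //= n IHn; rewrite up_Var IHn.
move=> /derivable_Alls_inst-/(_ f); rewrite subst_comp.
set A1 := subst _ _ A; suff -> : A1 = subst f g A by [].
by apply: subst_bound => i Hi; rewrite /= /g' ?Hi.
Qed.

Lemma derivable_subst G A f g :
  derivable T G A -> derivable T (map (subst f g) G) (subst f g A).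
Proof.
move=> D; elim: D f g => {G A} /=.
- by move=> G A TA f g; apply: axiom_subst.
- by move=> G A GA f g; apply: d_hyp; apply: List.in_map.
- by move=> G A B _ IH f g; apply: d_impI; apply: IH.
- by move=> G A B _ IH1 _ IH2 f g; apply: d_impE (IH1 f g) (IH2 f g).
- by move=> G A _ IH f g; apply: d_raa; apply: IH.
- move=> G A _ IH f g; apply: d_allI; have := IH (up f) g.
  by rewrite -!map_comp (eq_map (subst_shift f g)).
- move=> G A t _ IH f g; rewrite subst_inst -inst_subst_up; apply: d_allE; exact: IH.
- move=> G A _ IH f g; apply: d_allSI; have := IH f (upS g).
  by rewrite -!map_comp (eq_map (subst_shiftS f g)).
- move=> G A X _ IH f g; rewrite subst_instS -instS_subst_upS; apply: d_allSE; exact: IH.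
- by move=> *; apply: d_refl.
- move=> G A s t _ IH1 _ IH2 f g; rewrite subst_inst -inst_subst_up.
  apply: d_leibniz (IH1 f g) _; rewrite inst_subst_up -subst_inst; exact: IH2.
Qed.

Lemma map_In (X Y : Type) (f f' : X -> Y) (s : seq X) :
  (forall x, List.In x s -> f x = f' x) -> map f s = map f' s.
Proof.
by elim: s => //= x s IHs H; rewrite H ?IHs //; [move=> y ys; apply: H; right | left].
Qed.

(** A named eigenvariable in place of a shift: the renaming that sends [k] to [$0] and raises every
    other index turns the hypotheses into their shifts and [inst $k A] into [A]. *)
Lemma generalization G A k :
  (forall B, List.In B G -> bound B <= k) -> bound A <= k.+1 ->
  derivable T G (inst $k A) -> derivable T G (All A).
Proof.
move=> Gk Ak D; apply: d_allI.
have := derivable_subst (fun i => if i == k then $0 else $i.+1) id D.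
rewrite subst_inst /= eqxx.
have -> : subst ($0 .: fun i => if i == k then $0 else $i.+1) id A = A.
  by rewrite -[RHS]subst_id; apply: subst_bound => // -[|i] //= Hi; rewrite ltn_eqF // -ltnS (leq_trans Hi).
rewrite (@map_In _ _ _ shift) // => B /Gk Bk; apply: subst_bound => // i Hi.
by rewrite ltn_eqF // (leq_trans Hi).
Qed.

Lemma generalizationS G A k :
  (forall B, List.In B G -> boundS B <= k) -> boundS A <= k.+1 ->
  derivable T G (instS k A) -> derivable T G (AllS A).
Proof.
move=> Gk Ak D; apply: d_allSI.
have := derivable_subst Var (fun i => if i == k then 0 else i.+1) D.
rewrite subst_instS /= eqxx.
have -> : subst Var (0 .: fun i => if i == k then 0 else i.+1) A = A.
  by rewrite -[RHS]subst_id; apply: subst_bound => // -[|i] //= Hi; rewrite ltn_eqF // -ltnS (leq_trans Hi).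
rewrite (@map_In _ _ _ shiftS) // => B /Gk Bk; apply: subst_bound => // i Hi.
by rewrite ltn_eqF // (leq_trans Hi).
Qed.

End Derivations.

(** * Semantics and the completeness theorem *)

Record structure := Structure {
  dom :> Type;
  sets : Type;
  izero : dom;
  ione : dom;
  iadd : dom -> dom -> dom;
  imul : dom -> dom -> dom;
  iexp : dom -> dom -> dom;
  ilt : dom -> dom -> Prop;
  imem : dom -> sets -> Prop }.

Fixpoint eval (M : structure) (e : nat -> M) (t : term) : M :=
  match t with
  | Var n => e n
  | Zero => izero M
  | One => ione M
  | Add s t => iadd (eval e s) (eval e t)
  | Mul s t => imul (eval e s) (eval e t)
  | Exp s t => iexp (eval e s) (eval e t)
  end.

Fixpoint sat (M : structure) (e : nat -> M) (E : nat -> sets M) (A : form) : Prop :=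
  match A with
  | Eq s t => eval e s = eval e t
  | Lt s t => ilt (eval e s) (eval e t)
  | In t X => imem (eval e t) (E X)
  | Bot => False
  | Imp A B => sat e E A -> sat e E B
  | All A => forall x, sat (x .: e) E A
  | AllS A => forall X, sat e (X .: E) A
  end.

Definition is_model (T : form -> Prop) (M : structure) : Prop :=
  forall A, T A -> forall (e : nat -> M) E, sat e E A.

Fixpoint term_code (t : term) : nat :=
  match t with
  | Var n => CodeSeq.code [:: 0; n]
  | Zero => CodeSeq.code [:: 1]
  | One => CodeSeq.code [:: 2]
  | Add s t => CodeSeq.code [:: 3; term_code s; term_code t]
  | Mul s t => CodeSeq.code [:: 4; term_code s; term_code t]
  | Exp s t => CodeSeq.code [:: 5; term_code s; term_code t]
  end.

Lemma term_code_inj : injective term_code.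
Proof.
elim=> [n|||s IHs t IHt|s IHs t IHt|s IHs t IHt] [m|||s' t'|s' t'|s' t'];
move=> /(can_inj CodeSeq.codeK) //.
- by case=> ->.
- by case=> /IHs -> /IHt ->.
- by case=> /IHs -> /IHt ->.
- by case=> /IHs -> /IHt ->.
Qed.

Fixpoint form_code (A : form) : nat :=
  match A with
  | Eq s t => CodeSeq.code [:: 0; term_code s; term_code t]
  | Lt s t => CodeSeq.code [:: 1; term_code s; term_code t]
  | In t X => CodeSeq.code [:: 2; term_code t; X]
  | Bot => CodeSeq.code [:: 3]
  | Imp A B => CodeSeq.code [:: 4; form_code A; form_code B]
  | All A => CodeSeq.code [:: 5; form_code A]
  | AllS A => CodeSeq.code [:: 6; form_code A]
  end.

Lemma form_code_inj : injective form_code.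
Proof.
elim=> [s t|s t|t X||A IHA B IHB|A IHA|A IHA] [s' t'|s' t'|t' X'||A' B'|A'|A'];
move=> /(can_inj CodeSeq.codeK) //.
- by case=> /term_code_inj -> /term_code_inj ->.
- by case=> /term_code_inj -> /term_code_inj ->.
- by case=> /term_code_inj -> ->.
- by case=> /IHA -> /IHB ->.
- by case=> /IHA ->.
- by case=> /IHA ->.
Qed.

(** * The Henkin theory and its term model *)

Section Completeness.
Variables (T : form -> Prop) (A0 : form).
Hypothesis A0_unprovable : ~ proves T A0.

Definition consistent (G : seq form) : Prop := ~ derivable T G Bot.

Lemma derivable_exfalso G A : derivable T G Bot -> derivable T G A.
Proof. by move=> D; apply: d_raa; apply: weakening D _ => B HB; right. Qed.

Lemma In_cat (s1 s2 : seq form) B :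
  List.In B (s1 ++ s2) <-> List.In B s1 \/ List.In B s2.
Proof. exact: List.in_app_iff. Qed.

Definition form_enum (n : nat) : form :=
  epsilon (inhabits Bot) (fun A => form_code A = n).

Lemma form_enum_surj A : exists n, form_enum n = A.
Proof.
exists (form_code A); apply: form_code_inj.
by apply: (epsilon_spec (inhabits Bot) (fun B => form_code B = form_code A)); exists A.
Qed.

Definition fresh (G : seq form) : nat := \max_(B <- G) maxn (bound B) (boundS B).

Lemma freshP G B : List.In B G -> bound B <= fresh G /\ boundS B <= fresh G.
Proof.
rewrite /fresh; elim: G => //= A G IHG; rewrite big_cons => -[->|/IHG[]].
  by split; rewrite !leq_max leqnn ?orbT.
by move=> H1 H2; split; rewrite leq_max ?H1 ?H2 orbT.
Qed.

(** No constants are added to the language: variables beyond all bounds of the finite stage [G] act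
    as Henkin constants. Negated universal formulas suffice, since existential quantifiers
    abbreviate them. *)
Definition witness (G : seq form) (A : form) : seq form :=
  match A with
  | Imp (All B) Bot => [:: Not (inst $(fresh G) B)]
  | Imp (AllS B) Bot => [:: Not (instS (fresh G) B)]
  | _ => [::]
  end.

Lemma witness_consistent G A :
  List.In A G -> consistent G -> consistent (witness G A ++ G).
Proof.
case: A => // -[] // A [] // inG cG D; apply: cG;
apply: d_impE (d_hyp _ inG) _; have [b bS] := freshP inG.
- apply: (@generalization _ _ _ (fresh G)).
  + by move=> B /freshP[].
  + by move: b; rewrite /= maxn0; case: (bound A).
  + by apply: d_raa; exact: D.
- apply: (@generalizationS _ _ _ (fresh G)).
  + by move=> B /freshP[].
  + by move: bS; rewrite /= maxn0; case: (boundS A).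
  + by apply: d_raa; exact: D.
Qed.

Fixpoint henkin (n : nat) : seq form :=
  if n is p.+1 then
    let G := form_enum p :: henkin p in
    if excluded_middle_informative (consistent G)
    then witness G (form_enum p) ++ G else henkin p
  else [:: Not A0].

Lemma henkin_consistent n : consistent (henkin n).
Proof.
elim: n => [|n IHn] /=; first by move=> D; apply/A0_unprovable/d_raa.
case: excluded_middle_informative => // c.
by apply: witness_consistent => //; left.
Qed.

Lemma henkin_mono m n B : m <= n -> List.In B (henkin m) -> List.In B (henkin n).
Proof.
move=> /subnK <-; elim: (n - m) => //= k IHk HB; have {}HB := IHk HB.
case: excluded_middle_informative => // c.
by apply/In_cat; right; right.
Qed.

Definition thy (A : form) : Prop := exists n, derivable T (henkin n) A.

Lemma thy_impE A B : thy (A ->' B) -> thy A -> thy B.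
Proof.
move=> [n Dn] [m Dm]; exists (maxn n m); apply: (@d_impE _ _ A).
  by apply: weakening Dn _ => C; apply: henkin_mono; rewrite leq_max leqnn.
by apply: weakening Dm _ => C; apply: henkin_mono; rewrite leq_max leqnn orbT.
Qed.

Lemma thy0 A : derivable T [::] A -> thy A.
Proof. by move=> D; exists 0; apply: weakening D _. Qed.

Lemma thy_bot : ~ thy Bot.
Proof. by move=> [n]; apply: henkin_consistent. Qed.

(** A formula rejected at its stage is inconsistent with that stage, so its negation is already
    derivable there. *)
Lemma thy_excluded_middle A : thy A \/ thy (~' A).
Proof.
have [n nA] := form_enum_surj A.
case: (excluded_middle_informative (consistent (A :: henkin n))) => c.
  left; exists n.+1; rewrite /= nA.
  case: excluded_middle_informative => // c'; apply: d_hyp.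
  by apply/In_cat; right; left.
by right; exists n; apply: d_impI; apply: NNPP.
Qed.

Lemma thy_not A : thy (~' A) <-> ~ thy A.
Proof.
split=> [nA tA|nA]; first exact/thy_bot/(thy_impE nA tA).
by case: (thy_excluded_middle A).
Qed.

Lemma thy_imp A B : thy (A ->' B) <-> (thy A -> thy B).
Proof.
split=> [AB tA|AB]; first exact: thy_impE AB tA.
case: (thy_excluded_middle A) => [/AB|] [n D]; exists n; apply: d_impI.
  by apply: weakening D _; right.
apply: derivable_exfalso; apply: d_impE (d_hyp _ _); last by left.
by apply: weakening D _; right.
Qed.

Lemma thy_witness A :
  thy (~' A) -> exists2 G, List.In (~' A) G &
    forall B, List.In B (witness G (~' A)) -> thy B.
Proof.
move=> tA; have [n nA] := form_enum_surj (~' A).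
have c : consistent ((~' A) :: henkin n).
  move=> D; apply: thy_bot; apply: thy_impE tA; exists n.
  exact: d_impI.
exists ((~' A) :: henkin n); first by left.
move=> B HB; exists n.+1; rewrite /= nA.
case: excluded_middle_informative => // c'; apply: d_hyp.
by apply/In_cat; left.
Qed.

Lemma thy_all A : thy (All A) <-> forall t, thy (inst t A).
Proof.
split=> [[n D] t|H]; first by exists n; apply: d_allE.
apply: NNPP => /thy_not/thy_witness[G _ HG].
by have /thy_not := HG _ (or_introl erefl); apply; apply: H.
Qed.

Lemma thy_allS A : thy (AllS A) <-> forall X, thy (instS X A).
Proof.
split=> [[n D] X|H]; first by exists n; apply: d_allSE.
apply: NNPP => /thy_not/thy_witness[G _ HG].
by have /thy_not := HG _ (or_introl erefl); apply; apply: H.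
Qed.

Lemma thy_refl t : thy (t =' t).
Proof. by exists 0; apply: d_refl. Qed.

Lemma thy_leibniz A s t : thy (s =' t) -> thy (inst s A) -> thy (inst t A).
Proof.
move=> [n Dn] [m Dm]; exists (maxn n m); apply: (@d_leibniz _ _ _ s).
  by apply: weakening Dn _ => C; apply: henkin_mono; rewrite leq_max leqnn.
by apply: weakening Dm _ => C; apply: henkin_mono; rewrite leq_max leqnn orbT.
Qed.

Lemma inst_tlift s t : tsubst (s .: Var) (tlift 1 t) = t.
Proof. by rewrite /tlift tsubst_comp tsubst_id. Qed.

Lemma thy_sym s t : thy (s =' t) -> thy (t =' s).
Proof.
move=> st; have := @thy_leibniz ($0 =' tlift 1 s) s t st.
by rewrite !instE /= !inst_tlift; apply; apply: thy_refl.
Qed.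

Lemma thy_trans s t u : thy (s =' t) -> thy (t =' u) -> thy (s =' u).
Proof.
move=> st tu; have := @thy_leibniz (tlift 1 s =' $0) t u tu.
by rewrite !instE /= !inst_tlift; apply.
Qed.

(* The domain of the term model consists of chosen representatives modulo
   provable equality. *)
Definition rep (t : term) : term := epsilon (inhabits t) (fun s => thy (s =' t)).

Lemma rep_thy t : thy (rep t =' t).
Proof.
by apply: (epsilon_spec (inhabits t) (fun s => thy (s =' t))); exists t; apply: thy_refl.
Qed.

Lemma rep_eq s t : rep s = rep t <-> thy (s =' t).
Proof.
split=> [E|st].
  by apply: thy_trans (thy_sym (rep_thy s)) _; rewrite E; apply: rep_thy.
(* The default arguments of the two [epsilon] terms come from [s] and from [t], but as proofs of one
   proposition they coincide; only the predicates remain to be compared. *)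
rewrite /rep (proof_irrelevance _ (inhabits s) (inhabits t)); congr epsilon.
apply: functional_extensionality => u; apply: propositional_extensionality.
by split=> H; apply: thy_trans H _ => //; apply: thy_sym.
Qed.

Definition elt : Type := {t : term | rep t = t}.

Definition cls (t : term) : elt :=
  exist _ (rep t) (proj2 (rep_eq _ _) (rep_thy t)).

Lemma cls_eq s t : cls s = cls t <-> thy (s =' t).
Proof.
rewrite -rep_eq; split=> [[] //|E].
exact: subset_eq_compat.
Qed.

Lemma cls_val (x : elt) : cls (sval x) = x.
Proof. by case: x => t H; apply: subset_eq_compat. Qed.

(** The set sort consists of the set variables themselves: there is no equality between sets in the
    language, so only the number sort needs a quotient. *)
Definition henkin_model : structure :=
  @Structure elt nat (cls Zero) (cls One)
    (fun x y => cls (sval x +' sval y)) (fun x y => cls (sval x *' sval y))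
    (fun x y => cls (sval x ^^' sval y))
    (fun x y => thy (sval x <' sval y)) (fun x X => thy (sval x \in' X)).

Lemma thy_eq_congr (op : term -> term -> term) s s' t t' :
  (forall f u v, tsubst f (op u v) = op (tsubst f u) (tsubst f v)) ->
  thy (s =' s') -> thy (t =' t') -> thy (op s t =' op s' t').
Proof.
move=> opE ss tt; apply: (@thy_trans _ (op s' t)).
  have := @thy_leibniz (tlift 1 (op s t) =' op $0 (tlift 1 t)) s s' ss.
  by rewrite !instE /= !opE /= !inst_tlift; apply; apply: thy_refl.
have := @thy_leibniz (tlift 1 (op s' t) =' op (tlift 1 s') $0) t t' tt.
by rewrite !instE /= !opE /= !inst_tlift; apply; apply: thy_refl.
Qed.

Lemma eval_cls (f : nat -> term) t :
  @eval henkin_model (fun n => cls (f n)) t = cls (tsubst f t).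
Proof.
elim: t => //= s -> t ->; apply/cls_eq;
[apply: (@thy_eq_congr Add) | apply: (@thy_eq_congr Mul) | apply: (@thy_eq_congr Exp)];
by [|apply: rep_thy].
Qed.

Lemma thy_lt_rep s t : thy (rep s <' rep t) <-> thy (s <' t).
Proof.
have lt_congr a a' b b' : thy (a =' a') -> thy (b =' b') -> thy (a <' b) -> thy (a' <' b').
  move=> aa bb ab; have := @thy_leibniz ($0 <' tlift 1 b) a a' aa.
  rewrite !instE /= !inst_tlift => /(_ ab) a'b.
  have := @thy_leibniz (tlift 1 a' <' $0) b b' bb.
  by rewrite !instE /= !inst_tlift => /(_ a'b).
by split; apply: lt_congr; first [exact: rep_thy | exact/thy_sym/rep_thy].
Qed.

Lemma thy_in_rep t X : thy (rep t \in' X) <-> thy (t \in' X).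
Proof.
have in_congr a a' : thy (a =' a') -> thy (a \in' X) -> thy (a' \in' X).
  by move=> aa aX; have := @thy_leibniz ($0 \in' X) a a' aa; rewrite !instE; apply.
by split; apply: in_congr; first [exact: rep_thy | exact/thy_sym/rep_thy].
Qed.

Lemma scons_comp X Y (h : X -> Y) x f :
  (fun n => h ((x .: f) n)) = h x .: (fun n => h (f n)).
Proof. by apply: functional_extensionality => -[]. Qed.

Lemma truth A f (g : nat -> nat) :
  @sat henkin_model (fun n => cls (f n)) g A <-> thy (subst f g A).
Proof.
elim: A f g => /=.
- by move=> s t f g; rewrite !eval_cls; apply: cls_eq.
- by move=> s t f g; rewrite !eval_cls; apply: thy_lt_rep.
- by move=> t X f g; rewrite !eval_cls; apply: thy_in_rep.
- by move=> f g; split => // /thy_bot.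
- by move=> A IHA B IHB f g; rewrite thy_imp -IHA -IHB.
- move=> A IHA f g; rewrite thy_all; split=> [H t|H x].
    by rewrite inst_subst_up -IHA scons_comp; apply: H.
  by rewrite -(cls_val x) -scons_comp IHA -inst_subst_up; apply: H.
- move=> A IHA f g; rewrite thy_allS.
  by split=> H X; move: (H X); rewrite instS_subst_upS IHA.
Qed.

Lemma henkin_is_model : is_model T henkin_model.
Proof.
move=> A TA e E.
(* Each element is the class of its own representative, so the parameters of an axiom become a
   substitution. *)
have -> : e = (fun n => cls (sval (e n))).
  by apply: functional_extensionality => n; rewrite cls_val.
by apply/truth/thy0/axiom_subst.
Qed.

Lemma henkin_refutes : ~ @sat henkin_model (fun n => cls $n) id A0.
Proof.
move/truth; rewrite subst_id; apply/thy_not.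
by exists 0; apply: d_hyp; left.
Qed.

End Completeness.

Theorem completeness (T : form -> Prop) (A : form) :
  (forall M, is_model T M -> forall (e : nat -> M) E, sat e E A) -> proves T A.
Proof.
move=> H; apply: NNPP => nA; apply: (@henkin_refutes T A nA).
exact: H (henkin_is_model nA) _ _.
Qed.

(** * Semantic substitution *)

Section Satisfaction.
Variable M : structure.
Implicit Types (e : nat -> M) (E : nat -> sets M).

Lemma eval_tsubst e f t : eval e (tsubst f t) = eval (fun n => eval e (f n)) t.
Proof. by elim: t => //= s -> t ->. Qed.

Lemma eval_tlift n e t : eval e (tlift n t) = eval (fun i => e (n + i)) t.
Proof. exact: eval_tsubst. Qed.

Lemma eval_tlift1 x e t : eval (x .: e) (tlift 1 t) = eval e t.
Proof. exact: eval_tlift. Qed.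

Lemma sat_subst e E f g A :
  sat e E (subst f g A) <-> sat (fun n => eval e (f n)) (fun n => E (g n)) A.
Proof.
elim: A e E f g => /=.
- by move=> s t *; rewrite !eval_tsubst.
- by move=> s t *; rewrite !eval_tsubst.
- by move=> t X *; rewrite !eval_tsubst.
- by [].
- by move=> A IHA B IHB e E f g; rewrite IHA IHB.
- move=> A IHA e E f g.
  have upE x : (fun n => eval (x .: e) (up f n)) = x .: (fun n => eval e (f n)).
    by apply: functional_extensionality => -[|n] //=; rewrite eval_tlift1.
  by split=> H x; move: (H x); rewrite IHA upE.
- move=> A IHA e E f g.
  have upE X : (fun n => (X .: E) (upS g n)) = X .: (fun n => E (g n)).
    by apply: functional_extensionality => -[|n].
  by split=> H X; move: (H X); rewrite IHA upE.
Qed.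

Lemma sat_imp e E A B : sat e E (Imp A B) <-> (sat e E A -> sat e E B).
Proof. by []. Qed.

Lemma sat_all e E A : sat e E (All A) <-> forall x, sat (x .: e) E A.
Proof. by []. Qed.

Lemma sat_allS e E A : sat e E (AllS A) <-> forall X, sat e (X .: E) A.
Proof. by []. Qed.

Lemma sat_and e E A B : sat e E (And A B) <-> sat e E A /\ sat e E B.
Proof. by rewrite /=; tauto. Qed.

Lemma sat_or e E A B : sat e E (Or A B) <-> sat e E A \/ sat e E B.
Proof. by rewrite /=; tauto. Qed.

Lemma sat_iff e E A B : sat e E (Iff A B) <-> (sat e E A <-> sat e E B).
Proof. by rewrite /=; tauto. Qed.

Lemma sat_ex e E A : sat e E (Ex A) <-> exists x, sat (x .: e) E A.
Proof.
rewrite /=; split=> [H|[x Ax] H]; last exact: H Ax.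
by apply: NNPP => nex; apply: H => x Ax; apply: nex; exists x.
Qed.

Lemma sat_exS e E A : sat e E (ExS A) <-> exists X, sat e (X .: E) A.
Proof.
rewrite /=; split=> [H|[X AX] H]; last exact: H AX.
by apply: NNPP => nex; apply: H => X AX; apply: nex; exists X.
Qed.

Definition ile (x y : M) : Prop := ilt x y \/ x = y.

Lemma sat_le e E s t : sat e E (s <=' t) <-> ile (eval e s) (eval e t).
Proof. by rewrite sat_or. Qed.

End Satisfaction.

Definition satE := (sat_and, sat_or, sat_iff, sat_ex, sat_exS, sat_le).

Lemma Sigma00_subst f g A : Sigma00 A -> Sigma00 (subst f g A).
Proof.
have lift_up h t : tsubst (up h) (tlift 1 t) = tlift 1 (tsubst h t).
  by rewrite /tlift !tsubst_comp.
move=> S; elim: S f => /= {A}.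
- by move=> *; apply: s0_eq.
- by move=> *; apply: s0_lt.
- by move=> *; apply: s0_in.
- by move=> *; apply: s0_bot.
- by move=> A B _ IHA _ IHB f; apply: s0_imp.
- by move=> t A _ IHA f; rewrite lift_up; apply: s0_ball.
- by move=> t A _ IHA f; rewrite lift_up; apply: s0_bex.
Qed.

(** * Definability by bounded formulas *)

Declare Scope model_scope.
Delimit Scope model_scope with M.
Notation "0" := (izero _) : model_scope.
Notation "1" := (ione _) : model_scope.
Notation "x + y" := (iadd x y) : model_scope.
Notation "x * y" := (imul x y) : model_scope.
Notation "x ^ y" := (iexp x y) : model_scope.
Notation "x < y" := (ilt x y) : model_scope.
Notation "x <= y" := (ile x y) : model_scope.

Section Model.
Variable M : structure.
Hypothesis modelM : is_model RCA0star M.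
Hypothesis setsM : inhabited (sets M).
Local Open Scope model_scope.

Definition ecat (X : Type) (n : nat) (e p : nat -> X) (k : nat) : X :=
  if (k < n)%N then e k else p (k - n)%N.

(* [P] depends on the first [n] entries of the environment only, and is given
   by a bounded formula with number and set parameters from the model. *)
Definition definable (n : nat) (P : (nat -> M) -> Prop) : Prop :=
  exists A, Sigma00 A /\
    exists E p, forall e, P e <-> sat (ecat n e p) E A.

Definition termlike (n : nat) (f : (nat -> M) -> M) : Prop :=
  exists t p, forall e, f e = eval (ecat n e p) t.

(** Two lists of parameters are interleaved at even and odd positions, so that two formulas can
    share one environment. *)
Lemma ecat_merge (X : Type) (n : nat) (p1 p2 : nat -> X) :
  exists p r1 r2, forall e,
    (fun k => ecat n e p (r1 k)) = ecat n e p1 /\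
    (fun k => ecat n e p (r2 k)) = ecat n e p2.
Proof.
exists (fun i => if odd i then p2 i./2 else p1 i./2).
exists (fun k => if (k < n)%N then k else (n + (k - n).*2)%N).
exists (fun k => if (k < n)%N then k else (n + (k - n).*2.+1)%N).
move=> e; split; apply: functional_extensionality => k; rewrite /ecat;
case: (ltnP k n) => kn; rewrite ?kn // ltnNge leq_addr /= addKn.
  by rewrite odd_double doubleK.
by rewrite /= odd_double /= uphalf_double.
Qed.

Lemma definable_ext n (P Q : (nat -> M) -> Prop) :
  (forall e, P e <-> Q e) -> definable n P -> definable n Q.
Proof.
by move=> PQ [A [SA [E [p H]]]]; exists A; split=> //; exists E, p => e; rewrite -PQ.
Qed.

Lemma definable2 n P Q : definable n P -> definable n Q ->
  exists A B, Sigma00 A /\ Sigma00 B /\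
    exists E p, forall e, (P e <-> sat (ecat n e p) E A) /\
                          (Q e <-> sat (ecat n e p) E B).
Proof.
move=> [A [SA [E1 [p1 HA]]]] [B [SB [E2 [p2 HB]]]].
have [p [r1 [r2 Hp]]] := ecat_merge n p1 p2.
have [E [s1 [s2 HE]]] := ecat_merge 0 E1 E2.
exists (subst (fun k => $(r1 k)) s1 A), (subst (fun k => $(r2 k)) s2 B).
split; first exact: Sigma00_subst.
split; first exact: Sigma00_subst.
have unE k : ecat 0 E E k = E k by rewrite /ecat subn0.
exists E, p => e; rewrite !sat_subst /=; have [-> ->] := Hp e.
have [H1 H2] := HE E.
have -> : (fun k => E (s1 k)) = E1.
  transitivity (fun k => ecat 0 E E (s1 k)).
    by apply: functional_extensionality => k; rewrite unE.
  by rewrite H1; apply: functional_extensionality => k; rewrite /ecat subn0.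
have -> : (fun k => E (s2 k)) = E2.
  transitivity (fun k => ecat 0 E E (s2 k)).
    by apply: functional_extensionality => k; rewrite unE.
  by rewrite H2; apply: functional_extensionality => k; rewrite /ecat subn0.
by [].
Qed.

Lemma definable_imp n P Q : definable n P -> definable n Q ->
  definable n (fun e => P e -> Q e).
Proof.
move=> DP /(definable2 DP)[A [B [SA [SB [E [p H]]]]]].
exists (A ->' B); split; first exact: s0_imp.
by exists E, p => e /=; have [-> ->] := H e.
Qed.

Lemma definable_const n (Q : Prop) : definable n (fun _ => Q).
Proof.
case: setsM => X; case: (classic Q) => HQ; [exists (Bot ->' Bot) | exists Bot];
(split; first by repeat constructor); exists (fun _ => X), (fun _ => 0) => e /=; tauto.
Qed.

Lemma termlike_const n (a : M) : termlike n (fun _ => a).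
Proof.
by exists ($n), (fun _ => a) => e; rewrite /= /ecat ltnn.
Qed.

Lemma termlike_var n k : (k < n)%N -> termlike n (fun e => e k).
Proof. by move=> kn; exists ($k), (fun _ => 0) => e /=; rewrite /ecat kn. Qed.

Lemma termlike2 n f g : termlike n f -> termlike n g ->
  exists s t p, forall e, f e = eval (ecat n e p) s /\ g e = eval (ecat n e p) t.
Proof.
move=> [s [p1 Hs]] [t [p2 Ht]]; have [p [r1 [r2 Hp]]] := ecat_merge n p1 p2.
exists (tsubst (fun k => $(r1 k)) s), (tsubst (fun k => $(r2 k)) t), p => e.
by rewrite !eval_tsubst Hs Ht; have [<- <-] := Hp e.
Qed.

Lemma termlike_add n f g : termlike n f -> termlike n g ->
  termlike n (fun e => f e + g e).
Proof.
move=> Tf /(termlike2 Tf)[s [t [p H]]]; exists (s +' t), p => e /=.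
by have [-> ->] := H e.
Qed.

Lemma termlike_mul n f g : termlike n f -> termlike n g ->
  termlike n (fun e => f e * g e).
Proof.
move=> Tf /(termlike2 Tf)[s [t [p H]]]; exists (s *' t), p => e /=.
by have [-> ->] := H e.
Qed.

Lemma termlike_exp n f g : termlike n f -> termlike n g ->
  termlike n (fun e => f e ^ g e).
Proof.
move=> Tf /(termlike2 Tf)[s [t [p H]]]; exists (s ^^' t), p => e /=.
by have [-> ->] := H e.
Qed.

Lemma definable_eq_term n f g : termlike n f -> termlike n g ->
  definable n (fun e => f e = g e).
Proof.
move=> Tf /(termlike2 Tf)[s [t [p H]]]; exists (s =' t).
split; first exact: s0_eq.
by case: setsM => X; exists (fun _ => X), p => e /=; have [-> ->] := H e.
Qed.

Lemma definable_lt_term n f g : termlike n f -> termlike n g ->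
  definable n (fun e => f e < g e).
Proof.
move=> Tf /(termlike2 Tf)[s [t [p H]]]; exists (s <' t).
split; first exact: s0_lt.
by case: setsM => X; exists (fun _ => X), p => e /=; have [-> ->] := H e.
Qed.

Lemma definable_mem_term n f X : termlike n f ->
  definable n (fun e => imem (f e) X).
Proof.
move=> [t [p H]]; exists (t \in' 0%N); split; first exact: s0_in.
by exists (fun _ => X), p => e /=; rewrite H.
Qed.

Definition etail (e : nat -> M) : nat -> M := fun k => e k.+1.

Lemma ecatS n (e p : nat -> M) : ecat n.+1 e p = e 0%N .: ecat n (etail e) p.
Proof. by apply: functional_extensionality => -[]. Qed.

Lemma definable_ball_term n f (P : (nat -> M) -> M -> Prop) :
  termlike n f -> definable n.+1 (fun e => P (fun k => e k.+1) (e 0%N)) ->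
  definable n (fun e => forall y, y < f e -> P e y).
Proof.
move=> [t [p1 Ht]] [A [SA [E [p2 HA]]]].
have [p [r1 [r2 Hp]]] := ecat_merge n p1 p2.
exists (All ($0 <' tlift 1 (tsubst (fun k => $(r1 k)) t) ->'
             subst (up (fun k => $(r2 k))) id A)).
split; first by apply/s0_ball/Sigma00_subst.
exists E, p => e /=; rewrite Ht.
have Py y : P e y <-> sat (y .: ecat n e p) E (subst (up (fun k => $(r2 k))) id A).
  rewrite (HA (y .: e)) sat_subst ecatS /=.
  set e1 := (_ .: _); set e2 := (fun _ => _); suff -> : e1 = e2 by [].
  apply: functional_extensionality => -[|k] //=.
  by have [_ <-] := Hp e.
by split=> H y; move: (H y); rewrite eval_tlift1 eval_tsubst /= Py;
  have [-> _] := Hp e.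
Qed.

Lemma definable_rename m n P (r : nat -> nat) :
  (forall k, (k < m)%N -> (r k < n)%N) -> definable m P ->
  definable n (fun e => P (fun k => e (r k))).
Proof.
move=> rn [A [SA [E [p H]]]].
exists (subst (fun k => $(if (k < m)%N then r k else (k - m + n)%N)) id A).
split; first exact: Sigma00_subst.
exists E, p => e; rewrite H sat_subst /=.
set e1 := ecat _ _ _; set e2 := (fun _ => _); suff -> : e1 = e2 by [].
apply: functional_extensionality => k; rewrite /e1 /e2 /ecat.
case: (ltnP k m) => km; first by rewrite rn.
by rewrite ltnNge leq_addl /= addnK.
Qed.

Lemma definable_depends n P (e e' : nat -> M) :
  definable n P -> (forall k, (k < n)%N -> e k = e' k) -> P e <-> P e'.
Proof.
move=> [A [_ [E [p H]]]] ee; rewrite !H; suff -> : ecat n e p = ecat n e' p by [].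
by apply: functional_extensionality => k; rewrite /ecat; case: ifP => // /ee.
Qed.

Lemma definable_not n P : definable n P -> definable n (fun e => ~ P e).
Proof. by move=> DP; apply: definable_imp DP (definable_const n False). Qed.

Lemma definable_and n P Q : definable n P -> definable n Q ->
  definable n (fun e => P e /\ Q e).
Proof.
move=> DP DQ; apply: (@definable_ext _ (fun e => ~ (P e -> ~ Q e))) => [e|].
  by tauto.
by apply/definable_not/definable_imp/definable_not.
Qed.

Lemma definable_or n P Q : definable n P -> definable n Q ->
  definable n (fun e => P e \/ Q e).
Proof.
move=> DP DQ; apply: (@definable_ext _ (fun e => ~ P e -> Q e)) => [e|].
  by tauto.
by apply/definable_imp/DQ/definable_not.
Qed.

Lemma definable_iff n P Q : definable n P -> definable n Q ->
  definable n (fun e => P e <-> Q e).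
Proof. by move=> DP DQ; apply: definable_and; apply: definable_imp. Qed.

Lemma definable_bex_term n f (P : (nat -> M) -> M -> Prop) :
  termlike n f -> definable n.+1 (fun e => P (fun k => e k.+1) (e 0%N)) ->
  definable n (fun e => exists y, y < f e /\ P e y).
Proof.
move=> Tf DP.
apply: (@definable_ext _ (fun e => ~ forall y, y < f e -> ~ P e y)) => [e|].
  split=> [H|[y [yf Py]] H]; last exact: H Py.
  by apply: NNPP => nex; apply: H => y yf Py; apply: nex; exists y.
by apply/definable_not/definable_ball_term => //; apply: definable_not.
Qed.

Lemma definable_le_term n f g : termlike n f -> termlike n g ->
  definable n (fun e => f e <= g e).
Proof.
by move=> Tf Tg; apply: definable_or;
  [apply: definable_lt_term | apply: definable_eq_term].
Qed.

(** * Arithmetic in a model *)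

Implicit Types x y z : M.

Lemma model_axiom A e (X : sets M) : RCA0star A -> sat e (fun _ => X) A.
Proof. by move=> /modelM; apply. Qed.

Local Notation env2 x y := (x .: y .: fun _ => 0).

Ltac from_axiom ax e :=
  case: setsM => X; have := model_axiom e X ax; rewrite ?satE.

Lemma succ_neq0 x : x + 1 <> 0.
Proof. by from_axiom ax_succ_neq0 (env2 x x). Qed.

Lemma succ_inj x y : x + 1 = y + 1 -> x = y.
Proof. by from_axiom ax_succ_inj (env2 x y). Qed.

Lemma addm0 x : x + 0 = x.
Proof. by from_axiom ax_add0 (env2 x x). Qed.

Lemma addmS x y : x + (y + 1) = (x + y) + 1.
Proof. by from_axiom ax_addS (env2 x y). Qed.

Lemma mulm0 x : x * 0 = 0.
Proof. by from_axiom ax_mul0 (env2 x x). Qed.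

Lemma mulmS x y : x * (y + 1) = x * y + x.
Proof. by from_axiom ax_mulS (env2 x y). Qed.

Lemma ltm0 x : ~ x < 0.
Proof. by from_axiom ax_lt0 (env2 x x). Qed.

Lemma ltmS_or x y : x < y + 1 <-> x < y \/ x = y.
Proof. by from_axiom ax_ltS (env2 x y). Qed.

Lemma expm0 x : x ^ 0 = 1.
Proof. by from_axiom ax_exp0 (env2 x x). Qed.

Lemma expmS x y : x ^ (y + 1) = x * x ^ y.
Proof. by from_axiom ax_expS (env2 x y). Qed.

Lemma model_ind (P : M -> Prop) : definable 1 (fun e => P (e 0%N)) ->
  P 0 -> (forall x, P x -> P (x + 1)) -> forall x, P x.
Proof.
move=> [A [SA [E [p H]]]] P0 PS x.
have PA y : P y <-> sat (y .: p) E A.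
  rewrite (H (y .: p)) ecatS /=.
  by set q := ecat _ _ _; have -> : q = p by
    apply: functional_extensionality => k; rewrite /q /ecat subn0.
have H0 : sat p E (inst Zero A).
  rewrite /inst sat_subst; move/PA: P0; congr sat.
  by apply: functional_extensionality => -[].
have HS y : sat (y .: p) E A ->
    sat (y .: p) E (subst (fun n => if n is q.+1 then $q.+1 else $0 +' One) id A).
  move=> /PA/PS/PA; rewrite sat_subst; congr sat.
  by apply: functional_extensionality => -[].
have /sat_imp HI := modelM (ax_induction SA) p E.
by apply/PA; apply: HI; rewrite sat_and; split=> // y; apply: HS.
Qed.

(** A dummy quantifier makes a bounded formula both $\Sigma^0_1$ and $\Pi^0_1$. *)
Lemma comprehension (P : M -> Prop) : definable 1 (fun e => P (e 0%N)) ->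
  exists X : sets M, forall x, imem x X <-> P x.
Proof.
move=> [A [SA [E [p H]]]].
have PA y : P y <-> sat (y .: p) E A.
  rewrite (H (y .: p)) ecatS /=.
  by set q := ecat _ _ _; have -> : q = p by
    apply: functional_extensionality => k; rewrite /q /ecat subn0.
have S := Sigma00_subst (fun k => $k.+1) id SA.
have shA y z : sat (z .: y .: p) E (shift A) <-> P y by rewrite PA /shift sat_subst.
have /sat_imp HC := modelM (ax_comprehension (Sigma01_intro S) (Pi01_intro S)) p E.
have /HC/sat_exS[X HX] : sat p E (All (Ex (shift A) <->' All (shift A))).
  rewrite sat_all => y; rewrite sat_iff sat_ex; split=> [[z /shA Py] z'|Py]; first exact/shA.
  by exists 0; apply: Py.
exists X => y; have := proj1 (sat_all _ _ _) HX y; rewrite sat_iff /shiftS sat_subst sat_ex /= => ->.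
split=> [[z /shA]//|Py]; exists 0; exact/shA.
Qed.


Ltac termlike_tac := cbn beta; first
  [ apply: termlike_const | by apply: termlike_var
  | apply: termlike_add; termlike_tac | apply: termlike_mul; termlike_tac
  | apply: termlike_exp; termlike_tac ].

Ltac definable_tac := cbn beta; first
  [ assumption | by apply: definable_const
  | apply: definable_not => //; definable_tac
  | apply: definable_and => //; definable_tac
  | apply: definable_or => //; definable_tac
  | apply: definable_iff => //; definable_tac
  | apply: definable_eq_term => //; termlike_tac
  | apply: definable_le_term => //; termlike_tac
  | apply: definable_lt_term => //; termlike_tac
  | apply: definable_mem_term => //; termlike_tac
  | apply: definable_bex_term => //; [termlike_tac | definable_tac]
  | apply: definable_ball_term => //; [termlike_tac | definable_tac]
  | apply: definable_imp => //; definable_tac ].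

Lemma addmA x y z : x + (y + z) = x + y + z.
Proof.
elim/model_ind: z; first definable_tac; first by rewrite !addm0.
by move=> z IHz; rewrite !addmS IHz.
Qed.

Lemma add0m x : 0 + x = x.
Proof.
elim/model_ind: x; first definable_tac; first by rewrite addm0.
by move=> x IHx; rewrite addmS IHx.
Qed.

Lemma addSm x y : (x + 1) + y = (x + y) + 1.
Proof.
elim/model_ind: y; first definable_tac; first by rewrite !addm0.
by move=> y IHy; rewrite !addmS IHy.
Qed.

Lemma addmC x y : x + y = y + x.
Proof.
elim/model_ind: y; first definable_tac; first by rewrite add0m addm0.
by move=> y IHy; rewrite addmS addSm IHy.
Qed.

Lemma mul0m x : 0 * x = 0.
Proof.
elim/model_ind: x; first definable_tac; first by rewrite mulm0.
by move=> x IHx; rewrite mulmS IHx addm0.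
Qed.

Lemma mulSm x y : (x + 1) * y = x * y + y.
Proof.
elim/model_ind: y; first definable_tac; first by rewrite !mulm0 addm0.
move=> y IHy; rewrite !mulmS IHy -!addmA; congr (_ + _).
by rewrite !addmA [y + x]addmC.
Qed.

Lemma mulmC x y : x * y = y * x.
Proof.
elim/model_ind: y; first definable_tac; first by rewrite mul0m mulm0.
by move=> y IHy; rewrite mulmS mulSm IHy.
Qed.

Lemma mulmDr x y z : x * (y + z) = x * y + x * z.
Proof.
elim/model_ind: z; first definable_tac; first by rewrite mulm0 !addm0.
by move=> z IHz; rewrite addmS !mulmS IHz addmA.
Qed.

Lemma mulmDl x y z : (x + y) * z = x * z + y * z.
Proof. by rewrite mulmC mulmDr ![z * _]mulmC. Qed.

Lemma mulmA x y z : x * (y * z) = x * y * z.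
Proof.
elim/model_ind: z; first definable_tac; first by rewrite !mulm0.
by move=> z IHz; rewrite !mulmS mulmDr IHz.
Qed.

Lemma mul1m x : 1 * x = x.
Proof. by rewrite -[1]add0m mulSm mul0m add0m. Qed.

Lemma model_semiring : semi_ring_theory 0 1 (@iadd M) (@imul M) (@eq M).
Proof.
split; [exact: add0m | exact: addmC | exact: addmA | exact: mul1m | exact: mul0m
       | exact: mulmC | exact: mulmA | exact: mulmDl].
Qed.

Add Ring model_ring : model_semiring.

Lemma expmD x y z : x ^ (y + z) = x ^ y * x ^ z.
Proof.
elim/model_ind: z; first definable_tac; first by rewrite expm0 addm0; ring.
by move=> z IHz; rewrite addmA !expmS IHz; ring.
Qed.

Lemma expm1 x : x ^ 1 = x.
Proof. by rewrite -[1]add0m expmS expm0; ring. Qed.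

Lemma expmM x y z : x ^ (y * z) = (x ^ y) ^ z.
Proof.
elim/model_ind: z; first definable_tac; first by rewrite mulm0 !expm0.
by move=> z IHz; rewrite mulmS expmD IHz expmS; ring.
Qed.

Lemma addmI x y z : x + y = x + z -> y = z.
Proof.
elim/model_ind: x; first definable_tac; first by rewrite !add0m.
by move=> x IHx; rewrite !addSm => /succ_inj.
Qed.

Lemma ltm_addS x z : x < x + z + 1.
Proof.
elim/model_ind: z; first definable_tac.
  by apply/ltmS_or; right; rewrite addm0.
by move=> z IHz; apply/ltmS_or; left; rewrite addmA.
Qed.

(** Replaces the order by an equation, so that the later inequalities reduce to witnesses checked by
    [ring]. *)
Lemma ltmP x y : x < y <-> exists z, y = x + z + 1.
Proof.
split=> [|[z ->]]; last exact: ltm_addS.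
have ltSS (u v : M) : u < v -> u + 1 < v + 1.
  elim/model_ind: v; first definable_tac; first by move/ltm0.
  by move=> v IHv /ltmS_or[/IHv ?|->]; apply/ltmS_or; [left | right].
(* The witness is bounded by [y] to keep the induction formula bounded. *)
move=> xy; suff [z [_ ->]] : exists z, z < y /\ y = x + z + 1 by exists z.
move: xy; elim/model_ind: y; first definable_tac; first by move/ltm0.
move=> y IHy /ltmS_or[/IHy[z [zy yE]]|->].
  by exists (z + 1); split; [exact: ltSS | rewrite {1}yE; ring].
exists 0; split; last by ring.
by have := ltm_addS 0 y; rewrite add0m.
Qed.

Lemma lemP x y : x <= y <-> exists z, y = x + z.
Proof.
split=> [[/ltmP[z ->]| ->]|[z ->]].
- by exists (z + 1); ring.
- by exists 0; ring.
- elim/model_ind: z; first definable_tac; first by right; ring.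
  by move=> z _; left; apply/ltmP; exists z; ring.
Qed.

Lemma ltmm x : ~ x < x.
Proof.
move=> /ltmP[z E]; apply: (@succ_neq0 z); apply: (@addmI x).
by rewrite addm0 [RHS]E; ring.
Qed.

Lemma ltm_total x y : x < y \/ x = y \/ y < x.
Proof.
elim/model_ind: x; first definable_tac.
  elim/model_ind: y; first definable_tac; first by right; left.
  by move=> y _; left; apply/ltmP; exists y; ring.
move=> x [/ltmP[z ->]|[->|/ltmP[z ->]]].
- elim/model_ind: z; first definable_tac; first by right; left; ring.
  by move=> z _; left; apply/ltmP; exists z; ring.
- by right; right; apply/ltmP; exists 0; ring.
- by right; right; apply/ltmP; exists (z + 1); ring.
Qed.

Lemma lem_refl x : x <= x.
Proof. by right. Qed.

Lemma ltmW x y : x < y -> x <= y.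
Proof. by left. Qed.

Lemma lem0 x : 0 <= x.
Proof. by apply/lemP; exists x; ring. Qed.

Lemma lem_trans y x z : x <= y -> y <= z -> x <= z.
Proof. by move=> /lemP[u ->] /lemP[v ->]; apply/lemP; exists (u + v); ring. Qed.

Lemma ltm_lem_trans y x z : x < y -> y <= z -> x < z.
Proof. by move=> /ltmP[u ->] /lemP[v ->]; apply/ltmP; exists (u + v); ring. Qed.

Lemma lem_ltm_trans y x z : x <= y -> y < z -> x < z.
Proof. by move=> /lemP[u ->] /ltmP[v ->]; apply/ltmP; exists (u + v); ring. Qed.

Lemma ltm_trans y x z : x < y -> y < z -> x < z.
Proof. by move=> xy /ltmW; apply: ltm_lem_trans. Qed.

Lemma ltm_nge x y : x < y <-> ~ y <= x.
Proof.
split=> [xy yx|nyx]; first exact: ltmm (ltm_lem_trans xy yx).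
by case: (ltm_total x y) => // -[E|yx]; case: nyx; [right | left].
Qed.

Lemma lem_ngt x y : x <= y <-> ~ y < x.
Proof. by rewrite ltm_nge; split=> [xy|/NNPP]; [apply|]. Qed.

Lemma lem_or_gt x y : x <= y \/ y < x.
Proof. by case: (classic (x <= y)) => [|/ltm_nge]; [left | right]. Qed.

Lemma lem_anti x y : x <= y -> y <= x -> x = y.
Proof. by case=> // xy /lem_ngt. Qed.

Lemma ltm_neq x y : x < y -> x <> y.
Proof. by move=> xy E; apply: (@ltmm x); rewrite {2}E. Qed.

Lemma ltmS x y : x < y + 1 <-> x <= y.
Proof. exact: ltmS_or. Qed.

Lemma ltm_S x y : x < y <-> x + 1 <= y.
Proof.
by split=> [/ltmP|/lemP] [z ->]; [apply/lemP | apply/ltmP]; exists z; ring.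
Qed.

Lemma ltmm1 x : x < x + 1.
Proof. by apply/ltmS; right. Qed.

Lemma lem_addr x y : x <= x + y.
Proof. by apply/lemP; exists y. Qed.

Lemma lem_addl x y : x <= y + x.
Proof. by rewrite addmC; apply: lem_addr. Qed.

Lemma lem_add x y u v : x <= y -> u <= v -> x + u <= y + v.
Proof. by move=> /lemP[a ->] /lemP[b ->]; apply/lemP; exists (a + b); ring. Qed.

Lemma ltm_add_le x y u v : x < y -> u <= v -> x + u < y + v.
Proof. by move=> /ltmP[a ->] /lemP[b ->]; apply/ltmP; exists (a + b); ring. Qed.

Lemma lem_add2r z x y : x + z <= y + z <-> x <= y.
Proof.
split=> [|xy]; last exact: lem_add xy (lem_refl _).
rewrite !lem_ngt => H yx; apply: H; exact: ltm_add_le yx (lem_refl _).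
Qed.

Lemma ltm_add2r z x y : x + z < y + z <-> x < y.
Proof. by rewrite !ltm_nge lem_add2r. Qed.

Lemma lem_mul x y u v : x <= y -> u <= v -> x * u <= y * v.
Proof.
move=> /lemP[a ->] /lemP[b ->]; apply/lemP.
by exists (x * b + a * u + a * b); ring.
Qed.

Lemma ltm_pmul2r z x y : 0 < z -> x * z < y * z <-> x < y.
Proof.
move=> z_gt0; split=> [|/ltmP[u ->]].
  by rewrite !ltm_nge => H yx; apply: H; apply: lem_mul yx (lem_refl _).
by have /ltmP[v ->] := z_gt0; apply/ltmP; exists (u * (v + 1) + v); ring.
Qed.

Lemma ltm01 : (0 : M) < 1.
Proof. by apply/ltmP; exists 0; ring. Qed.

Lemma expm_gt0 x y : 0 < x -> 0 < x ^ y.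
Proof.
move=> x_gt0; elim/model_ind: y; first definable_tac; first by rewrite expm0; apply: ltm01.
by move=> y IHy; rewrite expmS mulmC -[0](mul0m x); apply/ltm_pmul2r.
Qed.

Lemma lem_exp2l x y z : 0 < x -> y <= z -> x ^ y <= x ^ z.
Proof.
move=> x_gt0 /lemP[u ->]; have := expm_gt0 u x_gt0.
rewrite ltm_S add0m expmD => /(lem_mul (lem_refl (x ^ y))).
by rewrite [_ * 1]mulmC mul1m.
Qed.

Lemma lem_exp2r x y z : x <= y -> x ^ z <= y ^ z.
Proof.
move=> xy; elim/model_ind: z; first definable_tac; first by rewrite !expm0; apply: lem_refl.
by move=> z IHz; rewrite !expmS; apply: lem_mul.
Qed.

Lemma least_number (P : M -> Prop) : definable 1 (fun e => P (e 0%N)) ->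
  forall x, P x -> exists y, y <= x /\ P y /\ forall z, z < y -> ~ P z.
Proof.
move=> DP x Px; apply: NNPP => none.
(* Course-of-values induction in bounded form: the quantifier over smaller numbers is part of the
   induction formula. *)
have all_not z : forall y, y < z -> ~ (y <= x /\ P y).
  elim/model_ind: z.
    have DP2 : definable 2 (fun e => P (e 0%N)).
      exact: (@definable_rename 1 2 _ (fun=> 0%N) _ DP).
    by definable_tac.
    by move=> y /ltm0.
  move=> z IHz y /ltmS_or[/IHz //|-> [zx Pz]]; apply: none; exists z.
  split=> //; split=> // u uz Pu; apply: (IHz u uz); split=> //.
  exact: lem_trans (ltmW uz) zx.
by apply: (all_not (x + 1) x (ltmm1 x)); split=> //; apply: lem_refl.
Qed.

(** * Bounded definable functions *)

(** The bounding term is what allows a value to be quantified away by a bounded quantifier. It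
    replaces function symbols, which the language lacks beyond sum, product and power. *)
Definition dfun (n : nat) (f : (nat -> M) -> M) : Prop :=
  definable n.+1 (fun e => e 0%N = f (fun k => e k.+1)) /\
  exists t, termlike n t /\ forall e, f e <= t e.

Implicit Types (f g : (nat -> M) -> M).

Lemma termlike_rename m n f (r : nat -> nat) :
  (forall k, (k < m)%N -> (r k < n)%N) -> termlike m f ->
  termlike n (fun e => f (fun k => e (r k))).
Proof.
move=> rn [t [p H]].
exists (tsubst (fun k => $(if (k < m)%N then r k else (k - m + n)%N)) t), p => e.
rewrite H eval_tsubst /=; congr eval; apply: functional_extensionality => k.
rewrite /ecat; case: (ltnP k m) => km; first by rewrite rn.
by rewrite ltnNge leq_addl /= addnK.
Qed.

Lemma dfun_rename m n f (r : nat -> nat) :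
  (forall k, (k < m)%N -> (r k < n)%N) -> dfun m f ->
  dfun n (fun e => f (fun k => e (r k))).
Proof.
move=> rn [Df [t [Tt ft]]]; split.
  apply: (@definable_rename m.+1 n.+1 _ (fun k => if k is k'.+1 then (r k').+1 else 0%N) _ Df).
  by move=> [|k] //=; rewrite !ltnS => /rn.
by exists (fun e => t (fun k => e (r k))); split=> //; apply: termlike_rename Tt.
Qed.

Lemma dfun_depends n f e e' :
  dfun n f -> (forall k, (k < n)%N -> e k = e' k) -> f e = f e'.
Proof.
move=> [Df _] ee.
have H : f e = f e <-> f e = f e'.
  by apply: (definable_depends (e := f e .: e) (e' := f e .: e') Df) => -[|k] //= /ee.
exact: (proj1 H).
Qed.

Lemma dfun_term n t : termlike n t -> dfun n t.
Proof.
move=> Tt; split; last by exists t; split=> // e; right.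
apply: definable_eq_term => //; first exact: termlike_var.
by apply: (@termlike_rename n n.+1 _ S).
Qed.

Lemma dfun_const n a : dfun n (fun _ => a).
Proof. exact/dfun_term/termlike_const. Qed.

Lemma dfun_var n k : (k < n)%N -> dfun n (fun e => e k).
Proof. by move=> kn; apply/dfun_term/termlike_var. Qed.

(** The value [f e] is named by a quantifier bounded by the term for [f], so substituting a
    definable function stays within bounded formulas. *)
Lemma definable_inst n (P : (nat -> M) -> M -> Prop) f :
  dfun n f -> definable n.+1 (fun e => P (fun k => e k.+1) (e 0%N)) ->
  definable n (fun e => P e (f e)).
Proof.
move=> [Df [t [Tt ft]]] DP.
apply: (@definable_ext _
  (fun e => exists y, y < t e + 1 /\ (y = f e /\ P e y))) => [e|].
  split=> [[y [_ [-> //]]]|Pf]; exists (f e); split=> //.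
  by apply/ltmS; apply: ft.
apply: definable_bex_term => //; last exact: definable_and.
by apply: termlike_add => //; apply: termlike_const.
Qed.

Lemma definable_eq n f g : dfun n f -> dfun n g -> definable n (fun e => f e = g e).
Proof. by move=> Df [Dg _]; apply: (@definable_inst n (fun e y => y = g e)). Qed.

Lemma dfun_S n f : dfun n f -> dfun n.+1 (fun e => f (fun k => e k.+1)).
Proof. exact: (@dfun_rename n n.+1 f S). Qed.

Lemma definable_lt n f g : dfun n f -> dfun n g -> definable n (fun e => f e < g e).
Proof.
move=> Df Dg; apply: (@definable_inst n (fun e y => y < g e)) => //.
apply: (@definable_inst n.+1 (fun e z => e 0%N < z)); first exact: dfun_S.
by definable_tac.
Qed.

Lemma definable_le n f g : dfun n f -> dfun n g -> definable n (fun e => f e <= g e).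
Proof.
by move=> Df Dg; apply: definable_or; [apply: definable_lt | apply: definable_eq].
Qed.

Lemma definable_mem n f X : dfun n f -> definable n (fun e => imem (f e) X).
Proof.
move=> Df; apply: (@definable_inst n (fun _ y => imem y X)) => //.
by definable_tac.
Qed.

Lemma definable_ball n f (P : (nat -> M) -> M -> Prop) :
  dfun n f -> definable n.+1 (fun e => P (fun k => e k.+1) (e 0%N)) ->
  definable n (fun e => forall y, y < f e -> P e y).
Proof.
move=> Df DP; apply: (@definable_inst n (fun e z => forall y, y < z -> P e y)) => //.
apply: (@definable_ball_term _ _ (fun e y => P (fun k => e k.+1) y)).
  exact: termlike_var.
by apply: (@definable_rename n.+1 n.+2 _ (fun k => if k is k'.+1 then k'.+2 else 0%N) _ DP) => -[].
Qed.

Lemma definable_ball_le n f (P : (nat -> M) -> M -> Prop) :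
  dfun n f -> definable n.+1 (fun e => P (fun k => e k.+1) (e 0%N)) ->
  definable n (fun e => forall y, y <= f e -> P e y).
Proof.
move=> Df DP; apply: (@definable_inst n (fun e z => forall y, y <= z -> P e y)) => //.
apply: (@definable_ext _ (fun e => forall y, y < e 0%N + 1 -> P (fun k => e k.+1) y)).
  by move=> e; split=> H y /ltmS; apply: H.
apply: (@definable_ball_term _ _ (fun e y => P (fun k => e k.+1) y)).
  by termlike_tac.
by apply: (@definable_rename n.+1 n.+2 _ (fun k => if k is k'.+1 then k'.+2 else 0%N) _ DP) => -[].
Qed.

Lemma definable_bex n f (P : (nat -> M) -> M -> Prop) :
  dfun n f -> definable n.+1 (fun e => P (fun k => e k.+1) (e 0%N)) ->
  definable n (fun e => exists y, y < f e /\ P e y).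
Proof.
move=> Df DP.
apply: (@definable_ext _ (fun e => ~ forall y, y < f e -> ~ P e y)) => [e|].
  split=> [H|[y [yf Py]] H]; last exact: H Py.
  by apply: NNPP => nex; apply: H => y yf Py; apply: nex; exists y.
by apply/definable_not/definable_ball => //; apply: definable_not.
Qed.

Lemma definable_bex_le n f (P : (nat -> M) -> M -> Prop) :
  dfun n f -> definable n.+1 (fun e => P (fun k => e k.+1) (e 0%N)) ->
  definable n (fun e => exists y, y <= f e /\ P e y).
Proof.
move=> Df DP.
apply: (@definable_ext _ (fun e => ~ forall y, y <= f e -> ~ P e y)) => [e|].
  split=> [H|[y [yf Py]] H]; last exact: H Py.
  by apply: NNPP => nex; apply: H => y yf Py; apply: nex; exists y.
by apply/definable_not/definable_ball_le => //; apply: definable_not.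
Qed.

Lemma dfun_add n f g : dfun n f -> dfun n g -> dfun n (fun e => f e + g e).
Proof.
move=> Df Dg; split; last first.
  have [_ [s [Ts fs]]] := Df; have [_ [t [Tt gt]]] := Dg.
  by exists (fun e => s e + t e); split=> [|e]; [apply: termlike_add | apply: lem_add].
apply: (@definable_inst n.+1 (fun e y => e 0%N = y + g (fun k => e k.+1))); first exact: dfun_S.
apply: (@definable_inst n.+2 (fun e y => e 1%N = e 0%N + y)); first exact: (dfun_S (dfun_S Dg)).
by definable_tac.
Qed.

Lemma dfun_mul n f g : dfun n f -> dfun n g -> dfun n (fun e => f e * g e).
Proof.
move=> Df Dg; split; last first.
  have [_ [s [Ts fs]]] := Df; have [_ [t [Tt gt]]] := Dg.
  by exists (fun e => s e * t e); split=> [|e]; [apply: termlike_mul | apply: lem_mul].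
apply: (@definable_inst n.+1 (fun e y => e 0%N = y * g (fun k => e k.+1))); first exact: dfun_S.
apply: (@definable_inst n.+2 (fun e y => e 1%N = e 0%N * y)); first exact: (dfun_S (dfun_S Dg)).
by definable_tac.
Qed.

Lemma dfun_exp n f g : dfun n f -> dfun n g -> dfun n (fun e => f e ^ g e).
Proof.
move=> Df Dg; split; last first.
  have [_ [s [Ts fs]]] := Df; have [_ [t [Tt gt]]] := Dg.
  (* The base is raised by one because powers of 0 are not monotone in the exponent: [0 ^ 0] is
     1. *)
  exists (fun e => (s e + 1) ^ t e); split=> [|e].
    by apply: termlike_exp => //; apply: termlike_add => //; apply: termlike_const.
  apply: (@lem_trans ((s e + 1) ^ g e)).
    by apply: lem_exp2r; apply: lem_trans (fs e) (lem_addr _ _).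
  by apply: lem_exp2l (gt e); apply/ltmS/lem0.
apply: (@definable_inst n.+1 (fun e y => e 0%N = y ^ g (fun k => e k.+1))); first exact: dfun_S.
apply: (@definable_inst n.+2 (fun e y => e 1%N = e 0%N ^ y)); first exact: (dfun_S (dfun_S Dg)).
by definable_tac.
Qed.

Definition ifm (P : Prop) (x y : M) : M :=
  if excluded_middle_informative P then x else y.

Lemma ifmT (P : Prop) x y : P -> ifm P x y = x.
Proof. by rewrite /ifm; case: excluded_middle_informative. Qed.

Lemma ifmF (P : Prop) x y : ~ P -> ifm P x y = y.
Proof. by rewrite /ifm; case: excluded_middle_informative. Qed.

Lemma dfun_if n P f g : definable n P -> dfun n f -> dfun n g ->
  dfun n (fun e => ifm (P e) (f e) (g e)).
Proof.
move=> DP [Df [s [Ts fs]]] [Dg [t [Tt gt]]]; split; last first.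
  exists (fun e => s e + t e); split=> [|e]; first exact: termlike_add.
  case: (classic (P e)) => HP; rewrite ?(ifmT _ _ HP) ?(ifmF _ _ HP).
    exact: lem_trans (fs e) (lem_addr _ _).
  exact: lem_trans (gt e) (lem_addl _ _).
have DPS : definable n.+1 (fun e => P (fun k => e k.+1)).
  exact: (@definable_rename n n.+1 P S).
apply: (@definable_ext _ (fun e =>
  (P (fun k => e k.+1) -> e 0%N = f (fun k => e k.+1)) /\
  (~ P (fun k => e k.+1) -> e 0%N = g (fun k => e k.+1)))) => [e|].
  by case: (classic (P (fun k => e k.+1))) => HP;
    rewrite ?(ifmT _ _ HP) ?(ifmF _ _ HP); tauto.
by apply: definable_and; apply: definable_imp => //; apply: definable_not.
Qed.

Definition least_below (b : M) (P : M -> Prop) (z : M) : Prop :=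
  z < b /\ P z /\ forall j, j < z -> ~ P j.

(* The least z below b satisfying P, or 0 if there is none. *)
Definition mu (b : M) (P : M -> Prop) : M :=
  epsilon (inhabits 0) (fun z => least_below b P z \/
                                 (z = 0 /\ forall i, i < b -> ~ P i)).

Lemma mu_spec b P : definable 1 (fun e => P (e 0%N)) ->
  least_below b P (mu b P) \/ (mu b P = 0 /\ forall i, i < b -> ~ P i).
Proof.
move=> DP; apply: (epsilon_spec (inhabits (0 : M)) (fun z => least_below b P z \/
                                 (z = 0 /\ forall i, i < b -> ~ P i))).
case: (classic (exists2 i, i < b & P i)) => [[i ib Pi]|none].
  have [y [yi [Py ymin]]] := least_number DP Pi; exists y; left.
  by split=> //; apply: lem_ltm_trans yi ib.
by exists 0; right; split=> // i ib Pi; apply: none; exists i.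
Qed.

Lemma mu_prop b P i : definable 1 (fun e => P (e 0%N)) ->
  i < b -> P i -> least_below b P (mu b P).
Proof. by move=> DP ib Pi; case: (mu_spec b DP) => // -[_ /(_ i ib)]. Qed.

Lemma mu_uniq b P i : definable 1 (fun e => P (e 0%N)) ->
  least_below b P i -> mu b P = i.
Proof.
move=> DP [ib [Pi imin]]; have [_ [Pm mmin]] := mu_prop DP ib Pi.
by case: (ltm_total (mu b P) i) => [lt|[//|lt]];
  [case: (imin _ lt Pm) | case: (mmin _ lt Pi)].
Qed.

Lemma mu_lt b P : definable 1 (fun e => P (e 0%N)) -> 0 < b -> mu b P < b.
Proof. by move=> DP b_gt0; case: (mu_spec b DP) => [[]//|[-> _]]. Qed.

Lemma mu_le b P : definable 1 (fun e => P (e 0%N)) -> mu b P <= b.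
Proof.
by move=> DP; case: (mu_spec b DP) => [[/ltmW]//|[-> _]]; apply: lem0.
Qed.

Lemma ecat0 (X : Type) (e p : nat -> X) : ecat 0 e p = p.
Proof. by apply: functional_extensionality => k; rewrite /ecat subn0. Qed.

Lemma definable_fix n P (e : nat -> M) :
  definable n.+1 P -> definable 1 (fun e' => P (e' 0%N .: e)).
Proof.
move=> [A [SA [E [p H]]]]; exists A; split=> //; exists E, (ecat n e p) => e'.
by rewrite H !ecatS ecat0.
Qed.

Lemma dfun_mu n b (P : (nat -> M) -> M -> Prop) :
  dfun n b -> definable n.+1 (fun e => P (fun k => e k.+1) (e 0%N)) ->
  dfun n (fun e => mu (b e) (P e)).
Proof.
move=> Db DP; split; last first.
  have [_ [t [Tt bt]]] := Db; exists t; split=> // e.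
  by apply: lem_trans (mu_le _ _) (bt e); exact: definable_fix e DP.
have DP2 : definable n.+2 (fun e => P (fun k => e k.+2) (e 0%N)).
  by apply: (@definable_rename n.+1 n.+2 _ (fun k => if k is k'.+1 then k'.+2 else 0%N) _ DP) => -[].
apply: (@definable_ext _ (fun e => let e' := fun k => e k.+1 in
  (e 0%N < b e' /\ P e' (e 0%N) /\ forall j, j < e 0%N -> ~ P e' j) \/
  (e 0%N = 0 /\ forall i, i < b e' -> ~ P e' i))) => [e|] /=.
  pose e' k := e k.+1; rewrite -/e'.
  have De : definable 1 (fun e0 => P e' (e0 0%N)) by exact: definable_fix e' DP.
  split=> [[H|[-> H]]|->]; last exact: mu_spec.
  - by rewrite (mu_uniq De H).
  - by case: (mu_spec (b e') De) => [[ib [Pi _]]|[->]] //; case: (H _ ib).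
apply: definable_or; apply: definable_and.
- by apply: definable_lt; [apply: dfun_var | apply: dfun_S].
- apply: definable_and => //.
  apply: (@definable_ball _ _ (fun e j => ~ P (fun k => e k.+1) j)); first exact: dfun_var.
  exact: definable_not.
- by definable_tac.
- apply: (@definable_ball _ _ (fun e j => ~ P (fun k => e k.+1) j)); first exact: dfun_S.
  exact: definable_not.
Qed.

(** Functions are substituted one place at a time. Those still waiting read the original arguments,
    which sit behind the [d] places. *)
Lemma definable_comp_aux d n P (G : nat -> (nat -> M) -> M) :
  definable (d + n) P -> (forall k, (k < d)%N -> dfun n (G k)) ->
  definable n (fun e => P (ecat d (fun k => G k e) e)).
Proof.
elim: d P G => [|d IHd] P G DP DG.
  suff E e : ecat 0 (fun k => G k e) e = e.
    by apply: definable_ext DP => e; rewrite E.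
  by apply: functional_extensionality => k; rewrite /ecat subn0.
have D0 : dfun (d + n) (fun e => G 0%N (fun k => e (d + k)%N)).
  by apply: (@dfun_rename n (d + n) _ (addn d)); [move=> k; rewrite ltn_add2l | apply: DG].
have D1 : definable (d + n) (fun e => P (G 0%N (fun k => e (d + k)%N) .: e)).
  apply: (@definable_inst (d + n) (fun e y => P (y .: e)) _ D0).
  by apply: definable_ext DP => e; rewrite scons_eta.
have := IHd _ (fun k => G k.+1) D1.
move=> H; apply: definable_ext (H _) => [e|k kd]; last exact: DG.
rewrite ecatS; suff -> : (fun k => ecat d (fun k0 => G k0.+1 e) e (d + k)) = e by [].
by apply: functional_extensionality => k; rewrite /ecat ltnNge leq_addr /= addKn.
Qed.

Lemma definable_comp d n P (G : nat -> (nat -> M) -> M) :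
  definable d P -> (forall k, (k < d)%N -> dfun n (G k)) ->
  definable n (fun e => P (fun k => G k e)).
Proof.
move=> DP DG.
have DP' : definable (d + n) P.
  by apply: (@definable_rename d (d + n) _ id) => // k kd; apply: ltn_addr.
apply: definable_ext (definable_comp_aux DP' DG) => e.
by apply: definable_depends DP _ => k kd; rewrite /ecat kd.
Qed.

(* The constant bound is needed because terms bounding F and G need not compose:
   a term bounding F need not be monotone. *)
Lemma dfun_comp d n F K (G : nat -> (nat -> M) -> M) :
  dfun d F -> (forall e, F e <= K) -> (forall k, (k < d)%N -> dfun n (G k)) ->
  dfun n (fun e => F (fun k => G k e)).
Proof.
move=> [DF _] FK DG; split; last by exists (fun _ => K); split=> //; apply: termlike_const.
apply: (@definable_comp d.+1 n.+1 (fun e => e 0%N = F (fun k => e k.+1))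
  (fun k e => if k is k'.+1 then G k' (fun i => e i.+1) else e 0%N)) => //.
by move=> [_|k kd] /=; [apply: dfun_var | apply/dfun_S/DG].
Qed.

(** * Colorings without long weakly homogeneous sequences *)

Ltac dfun_tac := cbn beta; first
  [ assumption | apply: dfun_const | by apply: dfun_var | by apply: dfun_S
  | apply: dfun_add; dfun_tac | apply: dfun_mul; dfun_tac
  | apply: dfun_exp; dfun_tac ].

(** * Truncated subtraction, quotients and the highest differing digit *)

Definition sub x y : M := mu (x + 1) (fun z => x = y + z).

Lemma sub_addK x y : sub (x + y) x = y.
Proof.
have D : definable 1 (fun e => x + y = x + e 0%N) by definable_tac.
rewrite /sub; apply: (mu_uniq (P := fun z => x + y = x + z)) => //.
split; first by apply/ltmS/lem_addl.
by split=> // j jy /addmI E; apply: ltm_neq jy _.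
Qed.

Lemma dfun_sub n f g : dfun n f -> dfun n g -> dfun n (fun e => sub (f e) (g e)).
Proof.
move=> Df Dg; apply: (@dfun_mu n (fun e => f e + 1) (fun e z => f e = g e + z)).
  by dfun_tac.
by apply: definable_eq; dfun_tac.
Qed.

(** The integer quotient of [x] by a positive [b]. Digits are compared only through quotients by
    powers of the base, which avoids remainders. *)
Definition quo b x : M := mu (x + 1) (fun q => x < (q + 1) * b).

Lemma m0_or_S x : x = 0 \/ exists y, x = y + 1.
Proof. by case: (ltm_total 0 x) => [/ltmP[z ->]|[<-|/ltm0]//]; [right; exists z; ring | left]. Qed.

Lemma quoP b x : 0 < b -> quo b x * b <= x /\ x < (quo b x + 1) * b.
Proof.
move=> b_gt0; have D : definable 1 (fun e => x < (e 0%N + 1) * b) by definable_tac.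
have : x < (x + 1) * b.
  apply: (@ltm_lem_trans ((x + 1) * 1)).
    by apply/ltmP; exists 0; ring.
  by apply/lem_mul; [apply: lem_refl | rewrite -[1]add0m; apply/ltm_S].
move=> /(mu_prop (P := fun q => x < (q + 1) * b) D (ltmm1 x)); rewrite -/(quo b x).
move=> [_ [lt qmin]]; split=> //; case: (m0_or_S (quo b x)) => [->|[q E]].
  by rewrite mul0m; apply: lem0.
by rewrite E; apply/lem_ngt/qmin; rewrite E; apply: ltmm1.
Qed.

Lemma dfun_quo n f g : dfun n f -> dfun n g -> dfun n (fun e => quo (f e) (g e)).
Proof.
move=> Df Dg; apply: (@dfun_mu n (fun e => g e + 1) (fun e q => g e < (q + 1) * f e)).
  by dfun_tac.
by apply: definable_lt; dfun_tac.
Qed.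

Lemma quo_le b x y : 0 < b -> x < y -> quo b x <= quo b y.
Proof.
move=> b_gt0 xy; apply/ltmS/(ltm_pmul2r _ _ b_gt0).
apply: lem_ltm_trans (proj1 (quoP x b_gt0)) _.
exact: ltm_trans xy (proj2 (quoP y b_gt0)).
Qed.

Lemma quo1 x : quo 1 x = x.
Proof.
have [le lt] := quoP x ltm01; apply: lem_anti.
  by have -> : quo 1 x = quo 1 x * 1 by ring.
by apply/ltmS; have -> : quo 1 x + 1 = (quo 1 x + 1) * 1 by ring.
Qed.

Lemma quo_small b x : x < b -> quo b x = 0.
Proof.
move=> xb; have b_gt0 : 0 < b by apply: lem_ltm_trans (lem0 x) xb.
have [le _] := quoP x b_gt0; apply: lem_anti; last exact: lem0.
apply/ltmS/(ltm_pmul2r _ _ b_gt0); apply: lem_ltm_trans le _.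
by rewrite add0m mul1m.
Qed.

(** With the higher digits fixed, [quo (b ^ i)] ranges over a block of [b] consecutive values. This
    is the pigeonhole behind both the coloring of pairs and the distinctness of neighbouring
    deltas. *)
Lemma quo_expS b i x : 0 < b ->
  quo (b ^ (i + 1)) x * b <= quo (b ^ i) x /\
  quo (b ^ i) x < (quo (b ^ (i + 1)) x + 1) * b.
Proof.
move=> b_gt0; have bi_gt0 := expm_gt0 i b_gt0.
have [le lt] := quoP x bi_gt0; have [le1 lt1] := quoP x (expm_gt0 (i + 1) b_gt0).
rewrite expmS in le1 lt1 *; split.
  apply/ltmS/(ltm_pmul2r _ _ bi_gt0); apply: lem_ltm_trans lt.
  by rewrite -mulmA.
apply/(ltm_pmul2r _ _ bi_gt0); apply: lem_ltm_trans le _.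
by rewrite -mulmA.
Qed.

(* The highest position below [n] where the base-[b] digits of [x] and [y] differ. *)
Definition delta b n x y : M :=
  mu n (fun i => quo (b ^ (i + 1)) x = quo (b ^ (i + 1)) y).

Ltac dfun_tac ::= cbn beta; first
  [ assumption | apply: dfun_const | by apply: dfun_var | by apply: dfun_S
  | apply: dfun_add; dfun_tac | apply: dfun_mul; dfun_tac
  | apply: dfun_exp; dfun_tac | apply: dfun_quo; dfun_tac ].

Lemma delta_definable b x y :
  definable 1 (fun e => quo (b ^ (e 0%N + 1)) x = quo (b ^ (e 0%N + 1)) y).
Proof. by apply: definable_eq; dfun_tac. Qed.

Lemma dfun_delta n f g h k : dfun n f -> dfun n g -> dfun n h -> dfun n k ->
  dfun n (fun e => delta (f e) (g e) (h e) (k e)).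
Proof.
move=> Df Dg Dh Dk; apply: (@dfun_mu n g
  (fun e i => quo (f e ^ (i + 1)) (h e) = quo (f e ^ (i + 1)) (k e))) => //.
by apply: definable_eq; dfun_tac.
Qed.

Lemma delta_lt b n x y : 0 < n -> delta b n x y < n.
Proof. by apply: mu_lt; apply: delta_definable. Qed.

Lemma delta_le b n x y : delta b n x y <= n.
Proof. by apply: mu_le; apply: delta_definable. Qed.

(** The search succeeds because at the top position [n - 1] both quotients vanish. Minimality of [i]
    makes the quotients by [b ^ i] differ; for [i = 0] this is [x < y] itself. *)
Lemma deltaP b n x y : 0 < b -> x < y -> y < b ^ n ->
  let i := delta b n x y in
  i < n /\ quo (b ^ (i + 1)) x = quo (b ^ (i + 1)) y /\
  quo (b ^ i) x < quo (b ^ i) y.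
Proof.
move=> b_gt0 xy yb i.
case: (m0_or_S n) => [n0|[n' nE]].
  by move: yb; rewrite n0 expm0 -[1]add0m => /ltmS/(ltm_lem_trans xy)/ltm0.
have n'n : n' < n by rewrite nE; apply: ltmm1.
have n'P : quo (b ^ (n' + 1)) x = quo (b ^ (n' + 1)) y.
  by rewrite -nE !quo_small //; apply: ltm_trans xy yb.
have := mu_prop (P := fun i => quo (b ^ (i + 1)) x = quo (b ^ (i + 1)) y)
  (delta_definable b x y) n'n n'P.
rewrite -/(delta b n x y) -/i => -[lt [eq imin]]; split=> //; split=> //.
have ne : quo (b ^ i) x <> quo (b ^ i) y.
  case: (m0_or_S i) => [->|[j jE]]; first by rewrite expm0 !quo1; apply: ltm_neq.
  by rewrite jE; apply: imin; rewrite jE; apply: ltmm1.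
by case: (quo_le (expm_gt0 i b_gt0) xy).
Qed.

(** * Standard numerals, colorability and the case of pairs *)

Fixpoint nm (k : nat) : M := if k is k'.+1 then nm k' + 1 else 0.

Lemma nmD j k : nm (j + k) = nm j + nm k.
Proof. by elim: j => [|j IHj]; rewrite /= ?add0m // IHj; ring. Qed.

Lemma lem_nm j k : (j <= k)%N -> nm j <= nm k.
Proof. by move=> /subnKC <-; rewrite nmD; apply: lem_addr. Qed.

Lemma nm_inj : injective nm.
Proof.
elim=> [|j IHj] [|k] //=; first by move/esym/succ_neq0.
- by move/succ_neq0.
- by move/succ_inj/IHj->.
Qed.

Lemma nm2_gt0 : 0 < nm 2.
Proof. by rewrite /= add0m; apply: ltm_trans ltm01 (ltmm1 _). Qed.

(** No nonstandard element lies below a standard numeral, so a bounded offset becomes a position in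
    a window indexed by the metatheory. *)
Lemma ltm_nmP x k : x < nm k -> exists2 j, (j < k)%N & x = nm j.
Proof.
elim: k => [/ltm0 //|k IHk] /= /ltmS[/IHk[j jk ->]|->]; last by exists k.
by exists j => //; apply: ltnW.
Qed.

(* Total and bounded, so that [dfun_comp] applies. *)
Definition dseq (h : M -> M) : Prop :=
  dfun 1 (fun e => h (e 0%N)) /\ exists K, forall x, h x <= K.

Lemma dfun_app n h f : dseq h -> dfun n f -> dfun n (fun e => h (f e)).
Proof.
move=> [Dh [K hK]] Df.
exact: (@dfun_comp 1 n (fun e => h (e 0%N)) K (fun _ => f)).
Qed.

Ltac dfun_tac ::= cbn beta; first
  [ assumption | apply: dfun_const | by apply: dfun_var | by apply: dfun_S
  | apply: dfun_add; dfun_tac | apply: dfun_mul; dfun_tac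
  | apply: dfun_exp; dfun_tac | apply: dfun_quo; dfun_tac
  | apply: dfun_sub; dfun_tac | apply: dfun_delta; dfun_tac
  | apply: dfun_app; [assumption | dfun_tac] ].

Ltac definable_tac ::= cbn beta; first
  [ assumption | by apply: definable_const
  | apply: definable_not; definable_tac
  | apply: definable_and; definable_tac
  | apply: definable_or; definable_tac
  | apply: definable_iff; definable_tac
  | apply: definable_eq; dfun_tac
  | apply: definable_le; dfun_tac
  | apply: definable_lt; dfun_tac
  | apply: definable_mem; dfun_tac
  | apply: definable_bex; [dfun_tac | definable_tac]
  | apply: definable_ball; [dfun_tac | definable_tac]
  | apply: definable_imp; definable_tac ].

Definition window (h : M -> M) (i : M) : nat -> M := fun k => h (i + nm k).

(** The entries [h 0], ..., [h m] form a sequence of [m + 1] elements, and [i + nm d <= m] says that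
    the windows at [i] and [i + 1] both fit. Sequences are definable functions, so the deltas of a
    sequence are again admissible. *)
Definition avoids (d : nat) (F : (nat -> M) -> M) (n m : M) : Prop :=
  forall h, dseq h -> (forall i, i <= m -> h i < n) ->
  (forall i, i < m -> h i < h (i + 1)) ->
  ~ (forall i, i + nm d <= m -> F (window h i) = F (window h (i + 1))).

Definition colorable (d : nat) (K n m : M) : Prop :=
  exists F, dfun d F /\ (forall e, F e < K) /\ avoids d F n m.

Lemma colorable_pairs K p : 0 < K -> 1 < p -> colorable 2 K (p ^ K) p.
Proof.
move=> K_gt0 p_gt1; exists (fun e => delta p K (e 0%N) (e 1%N)); split.
  by apply: dfun_delta; dfun_tac.
split=> [e|h Dh hn hS hom]; first exact: delta_lt.
have p_gt0 : 0 < p := ltm_trans ltm01 p_gt1.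
set t := delta p K (h 0) (h (0 + 1)).
have hp k : k < p -> h k < h (k + 1) /\ h (k + 1) < p ^ K.
  by move=> kp; split; [apply: hS | apply/hn/ltm_S].
have const k : k < p -> delta p K (h k) (h (k + 1)) = t.
  elim/model_ind: k => [|//|k IHk kp].
    by definable_tac.
  have {}IHk := IHk (ltm_trans (ltmm1 k) kp).
  have := hom k; rewrite /window /= !addmA !addm0 IHk => -> //.
  exact/ltm_S.
(* Under constant delta [t] each step raises the quotient by [p ^ t] and keeps the higher digits. At
   [k = p] it would leave its block of [p] values. *)
have claim k : k <= p -> quo (p ^ (t + 1)) (h k) = quo (p ^ (t + 1)) (h 0) /\
    quo (p ^ t) (h 0) + k <= quo (p ^ t) (h k).
  elim/model_ind: k => [||k IHk /ltm_S kp].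
  - by definable_tac.
  - by move=> _; split=> //; rewrite addm0; apply: lem_refl.
  have [E le] := IHk (ltmW kp); have [hk hk1] := hp k kp.
  have [_ [E' lt]] := deltaP p_gt0 hk hk1; rewrite const // in E' lt.
  rewrite -E' E; split=> //; rewrite addmA; apply/ltm_S.
  exact: lem_ltm_trans le lt.
have [E le] := claim p (lem_refl p); apply: (@ltmm (quo (p ^ t) (h p))).
apply: ltm_lem_trans le; apply: ltm_lem_trans (proj2 (quo_expS t (h p) p_gt0)) _.
rewrite E mulmDl mul1m; apply: lem_add; last exact: lem_refl.
exact: proj1 (quo_expS t (h 0) p_gt0).
Qed.

(** * Stepping up the dimension by one *)

Definition asb (P : Prop) : bool :=
  if excluded_middle_informative P then true else false.

Lemma asbP (P : Prop) : reflect P (asb P).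
Proof. by rewrite /asb; case: excluded_middle_informative => HP; constructor. Qed.

(** The stepped-up coloring chooses its formula by a list of truth values; splitting off one bit at
    a time turns the choice into nested [ifm]. *)
Lemma dfun_asb n (Phi : seq bool -> (nat -> M) -> M) (P : nat -> (nat -> M) -> Prop) l :
  (forall s, dfun n (Phi s)) -> (forall k, k \in l -> definable n (P k)) ->
  dfun n (fun e => Phi [seq asb (P k e) | k <- l] e).
Proof.
elim: l Phi => [|k l IHl] Phi DPhi DP /=; first exact: DPhi.
have -> : (fun e => Phi (asb (P k e) :: [seq asb (P k e) | k <- l]) e) =
  (fun e => ifm (P k e) (Phi (true :: [seq asb (P k e) | k <- l]) e)
                        (Phi (false :: [seq asb (P k e) | k <- l]) e)).
  apply: functional_extensionality => e; rewrite /ifm {1}/asb.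
  by case: (excluded_middle_informative (P k e)).
apply: dfun_if; first by apply: DP; rewrite inE eqxx.
  by apply: (IHl (fun s => Phi (true :: s))) => // j jl; apply: DP; rewrite inE jl orbT.
by apply: (IHl (fun s => Phi (false :: s))) => // j jl; apply: DP; rewrite inE jl orbT.
Qed.

(* Separates the ascent patterns of two consecutive windows: the length of the
   initial run drops by one, unless it is 1 and the first bit flips. *)
Definition run_code (s : seq bool) : nat :=
  ((head false s).*2 + odd (find (predC1 (head false s)) s))%N.

Lemma run_code_lt4 s : (run_code s < 4)%N.
Proof. by rewrite /run_code; case: (head _ _); case: (odd _). Qed.

Lemma run_code_shift (x y : bool) (s : seq bool) :
  has (predC1 x) s -> run_code (x :: s) != run_code (rcons s y).
Proof.
case: s => [|z s] // has_s; rewrite /run_code /= eqxx /=.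
(* If the second bit repeats the first, the run ends inside [s], so the appended bit is invisible
   and the run lengths differ by one. Otherwise the leading bit changes. *)
case: (eqVneq z x) has_s => [-> /= has_s|zx _].
  rewrite eqxx /= -cats1 find_cat.
  rewrite /= eqxx /= in has_s; rewrite has_s eqn_add2l /=.
  by case: (odd _).
by case: z x zx => -[] //= _; case: (odd _).
Qed.

Lemma not_all_has (x : bool) (s : seq bool) :
  ~~ all id (x :: s) -> has id (x :: s) -> has (predC1 x) s.
Proof.
rewrite -has_predC; case: x => /=; first by move=> H _; apply: sub_has H => -[].
by move=> _; apply: sub_has => -[].
Qed.

Section SteppingUp.
Variables (d : nat) (K n m : M) (F : (nat -> M) -> M).
Hypotheses (d_ge2 : (1 < d)%N) (n_gt0 : 0 < n) (dm : nm d <= m).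
Hypotheses (DF : dfun d F) (FK : forall e, F e < K) (avF : avoids d F n m).

Let dlt (e : nat -> M) (k : nat) : M := delta (nm 2) n (e k) (e k.+1).

Let ascents (e : nat -> M) : seq bool :=
  [seq asb (dlt e k < dlt e k.+1) | k <- iota 0 d.-1].

(** A decreasing window is handed to [F] backwards, so that [F] again meets an increasing tuple. *)
Let color (s : seq bool) (e : nat -> M) : M :=
  if all id s then F (dlt e)
  else if ~~ has id s then K + F (fun k => dlt e (d.-1 - k))
  else K + K + nm (run_code s).

Let stepF (e : nat -> M) : M := color (ascents e) e.

(** For [d = 2] the ascent pattern is a single bit, hence never mixed. *)
Let extra : nat := (if d == 2 then 0 else 4)%N.

Lemma dfun_stepF : dfun d.+1 stepF.
Proof.
have Ddlt k : (k < d)%N -> dfun d.+1 (fun e => dlt e k).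
  by move=> kd; apply: dfun_delta; try exact: dfun_const; apply: dfun_var;
    rewrite // ltnS ltnW.
have FK' e : F e <= K by apply/ltmW/FK.
apply: (@dfun_asb d.+1 color (fun k e => dlt e k < dlt e k.+1)) => [s|k].
  rewrite /color; case: (all id s).
    exact: (dfun_comp (G := fun k e => dlt e k) DF FK' Ddlt).
  case: (~~ has id s); last exact: dfun_const.
  apply: dfun_add; first exact: dfun_const.
  apply: (dfun_comp (G := fun k e => dlt e (d.-1 - k)) DF FK') => k kd.
  by apply: Ddlt; rewrite (leq_ltn_trans (leq_subr _ _)) // prednK // ltnW.
rewrite mem_iota add0n /= => kd.
by apply: definable_lt; apply: Ddlt; lia.
Qed.

Lemma stepF_lt e : stepF e < K + K + nm extra.
Proof.
have KK : K + K <= K + K + nm extra by apply: lem_addr.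
rewrite /stepF /color; case: ifP => [_|nall].
  exact: ltm_lem_trans (FK _) (lem_trans (lem_addr _ _) KK).
case: ifP => [_|/negbFE hasb].
  rewrite addmC; apply: ltm_lem_trans KK; apply: ltm_add_le => //; exact: lem_refl.
rewrite addmC [X in _ < X]addmC; apply: ltm_add_le; last exact: lem_refl.
rewrite /extra; case: eqP => [d2|_]; last first.
  exact/ltm_S/(lem_nm (run_code_lt4 _)).
by move: nall hasb; rewrite /ascents d2 /= andbT orbF => ->.
Qed.

Section Sequence.
Variable h : M -> M.
Hypotheses (Dh : dseq h) (hn : forall i, i <= m + 1 -> h i < nm 2 ^ n)
  (hS : forall i, i < m + 1 -> h i < h (i + 1))
  (hom : forall i, i + nm d.+1 <= m + 1 ->
           stepF (window h i) = stepF (window h (i + 1))).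

Let D (i : M) : M := delta (nm 2) n (h i) (h (i + 1)).

Lemma dlt_window i k : dlt (window h i) k = D (i + nm k).
Proof. by rewrite /dlt /D /window /= addmA. Qed.

Lemma dseq_D : dseq D.
Proof.
split; last by exists n => x; apply: delta_le.
by rewrite /D; dfun_tac.
Qed.

Lemma D_lt i : i <= m -> D i < n.
Proof. by move=> _; apply: delta_lt. Qed.

(** If two neighbouring deltas agreed, the quotient by that power of 2 would rise twice while the
    higher bits stay fixed, leaving its block of two values. *)
Lemma D_neq i : i < m -> D i <> D (i + 1).
Proof.
move=> im E.
have im1 : i + 1 < m + 1 by apply/ltm_add2r.
have [_ [E1 lt1]] := deltaP nm2_gt0 (hS (ltm_trans (ltmm1 i) im1)) (hn (ltmW im1)).
have [_ [E2 lt2]] := deltaP nm2_gt0 (hS im1) (hn (proj1 (ltm_S _ _) im1)).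
rewrite -/(D i) -/(D (i + 1)) -E in E1 lt1 E2 lt2.
have [le _] := quo_expS (D i) (h i) nm2_gt0.
have [_ lt] := quo_expS (D i) (h (i + 1 + 1)) nm2_gt0.
rewrite -E2 -E1 in lt; move/ltm_S: lt1 => lt1; move/ltm_S: lt2 => lt2.
set X := quo (nm 2 ^ D i) (h i) in le lt1.
apply: (@ltmm (X + nm 2)); apply: (@lem_ltm_trans (quo (nm 2 ^ D i) (h (i + 1 + 1)))).
  have -> : X + nm 2 = X + 1 + 1 by rewrite /= add0m addmA.
  by apply: lem_trans lt2; apply/lem_add2r.
apply: ltm_lem_trans lt _; rewrite mulmDl mul1m.
by apply: lem_add le _; apply: lem_refl.
Qed.

Let W (i : M) : M := stepF (window h i).
Let asc (i : M) : seq bool := ascents (window h i).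

Lemma W_const i : i + nm d <= m + 1 -> W i = W 0.
Proof.
have DW : dfun 1 (fun e => W (e 0%N)).
  apply: (dfun_comp (G := fun k e => h (e 0%N + nm k)) dfun_stepF (fun e => ltmW (stepF_lt e))).
  by move=> k _; dfun_tac.
elim/model_ind: i => [|//|i IHi im]; first by definable_tac.
have iS : i + nm d.+1 = i + 1 + nm d by rewrite /=; ring.
rewrite -IHi; first by rewrite /W -hom // iS.
by apply: lem_trans im; apply/lem_add2r/lem_addr.
Qed.

Lemma ascE i : asc i = [seq asb (D (i + nm k) < D (i + nm k + 1)) | k <- iota 0 d.-1].
Proof. by apply: eq_map => k; rewrite !dlt_window /= addmA. Qed.

Lemma W_cases i :
  (all id (asc i) /\ W i = F (window D i)) \/
  (~~ has id (asc i) /\ W i = K + F (fun k => D (i + nm (d.-1 - k)))) \/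
  (~~ all id (asc i) /\ has id (asc i) /\ W i = K + K + nm (run_code (asc i))).
Proof.
have dltE : dlt (window h i) = window D i.
  by apply: functional_extensionality => k; apply: dlt_window.
rewrite /W /stepF /color -/(asc i); case: ifP => [_|_]; first by left; rewrite dltE.
case: ifP => [nhas|/negbFE hasb]; last by right; right.
by right; left; rewrite dltE.
Qed.

Lemma asc_all i k : all id (asc i) -> (k < d.-1)%N -> D (i + nm k) < D (i + nm k + 1).
Proof.
rewrite ascE all_map => /allP H kd.
by have := H k; rewrite mem_iota add0n /= => /(_ kd)/asbP.
Qed.

Lemma asc_none i k : ~~ has id (asc i) -> (k < d.-1)%N ->
  ~ D (i + nm k) < D (i + nm k + 1).
Proof.
rewrite ascE has_map => /hasPn H kd.
by have := H k; rewrite mem_iota add0n /= => /(_ kd)/asbP.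
Qed.

(** An index too close to the end to start a window lies in the last window, which starts at
    [m + 1 - d]; it exists because [nm d <= m]. *)
Lemma windows_cover (P : M -> Prop) :
  (forall i k, i + nm d <= m + 1 -> (k < d.-1)%N -> P (i + nm k)) ->
  forall i, i < m -> P i.
Proof.
move=> HP i im; case: (lem_or_gt (i + nm d) (m + 1)) => [id|].
  by have := HP i 0%N id; rewrite /= addm0; apply; lia.
have /lemP[c mE] := dm; have dE : nm d = nm d.-1 + 1 by case: (d) d_ge2.
have -> : m + 1 = c + 1 + nm d by rewrite mE; ring.
move=> /ltm_add2r/ltmW/lemP[u iE]; rewrite iE.
have /ltm_nmP[k kd ->] : u < nm d.-1.
  apply/(ltm_add2r (c + 1)); move: im; rewrite iE mE dE.
  have -> : nm d.-1 + 1 + c = nm d.-1 + (c + 1) by ring.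
  by rewrite [u + _]addmC.
by apply: HP kd; rewrite mE; right; ring.
Qed.

Lemma no_homogeneous : False.
Proof.
have W_le i : i + nm d <= m -> W i = W (i + 1).
  by move=> im; apply: hom; rewrite /= addmA; apply/lem_add2r.
have small i : W i < K -> all id (asc i) /\ W i = F (window D i).
  case: (W_cases i) => [//|[[_ ->]|[_ [_ ->]]]] /ltm_nge[].
    exact: lem_addr.
  by rewrite -addmA; apply: lem_addr.
case: (W_cases 0) => [[all0 W0]|[[none0 W0]|[nall0 [has0 W0]]]].
- have allW i : i + nm d <= m + 1 -> all id (asc i) /\ W i = F (window D i).
    by move=> im; apply: small; rewrite W_const // W0.
  apply: (avF dseq_D D_lt).
    apply: windows_cover => i k im kd.
    by apply: asc_all kd; have [] := allW i im.
  move=> i im; have im1 : i + 1 + nm d <= m + 1.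
    have -> : i + 1 + nm d = i + nm d + 1 by ring.
    by apply/lem_add2r.
  have [_ <-] := allW (i + 1) im1; have [|_ <-] := allW i; last exact: W_le.
  exact: lem_trans im (lem_addr _ _).
- have noneW i : i + nm d <= m + 1 ->
      ~~ has id (asc i) /\ W i = K + F (fun k => D (i + nm (d.-1 - k))).
    move=> im; have := W_const im; rewrite W0.
    case: (W_cases i) => [[_ ->] E|[//|[_ [_ ->]] E]].
      by case/ltm_nge: (FK (window D i)); rewrite E; apply: lem_addr.
    move: (FK (fun k => D (0 + nm (d.-1 - k)))) => /ltm_nge[].
    have -> : F (fun k => D (0 + nm (d.-1 - k))) = K + nm (run_code (asc i)).
      by apply: (@addmI K); rewrite -E addmA.
    exact: lem_addr.
  (* The pattern only denies ascents; distinctness of neighbours makes the descent strict. *)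
  have decr i : i < m -> D (i + 1) < D i.
    move=> im; have nlt : ~ D i < D (i + 1).
      apply: (windows_cover (P := fun i => ~ D i < D (i + 1))) im => j k jm.
      by apply: asc_none; have [] := noneW j jm.
    by case: (ltm_total (D i) (D (i + 1))) => [//|[/(D_neq im)|]].
  have subE i j : m = i + j -> sub m i = j by move=> ->; apply: sub_addK.
  (* Reversal makes the deltas increasing. Beyond [m] the subtraction defaults to 0, so the reversed
     sequence is still total and bounded. *)
  have Dg : dseq (fun i => D (sub m i)).
    split; last by exists n => x; apply: delta_le.
    by have DD := dseq_D; dfun_tac.
  apply: (avF Dg) => [i im|i im|i /lemP[w mE]].
  + exact: delta_lt.
  + have /ltmP[w mE] := im; rewrite (subE i (w + 1)) ?(subE (i + 1) w); try by rewrite mE; ring.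
    by apply: decr; rewrite mE; apply/ltmP; exists i; ring.
  have win v : v <= w + 1 -> K + F (fun k => D (v + nm (d.-1 - k))) = W v.
    move=> vw; have [|_ ->] // := noneW v; rewrite mE.
    have -> : i + nm d + w + 1 = i + (w + 1 + nm d) by ring.
    by apply: lem_trans (lem_addl _ _); apply/lem_add2r.
  (* Under [i |-> m - i] the window at [j] becomes the window at [v] read backwards, which is how
     the second palette feeds [F]. *)
  have flip (v j : M) : m = j + nm d.-1 + v ->
      F (window (fun i => D (sub m i)) j) = F (fun k => D (v + nm (d.-1 - k))).
    move=> E; apply: (dfun_depends DF) => k kd; congr D; apply: subE.
    have kd' : (k <= d.-1)%N by lia.
    by rewrite {1}E -{1}(subnKC kd') nmD; ring.
  have dE : nm d = nm d.-1 + 1 by case: (d) d_ge2.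
  apply: (@addmI K).
  rewrite (flip (w + 1) i) ?(flip w (i + 1)); try by rewrite mE dE; ring.
  rewrite !win; [|exact: lem_addr|exact: lem_refl].
  apply/esym/W_le; rewrite mE; have -> : i + nm d + w = i + (w + nm d) by ring.
  exact: lem_addl.
(* A mixed window at 0 is refuted by the window at 1 alone: equal colors put it into the third
   palette too, but the run code changes under a shift by one. *)
- have W1 : W 1 = W 0 by rewrite -[1]add0m -W_le // add0m.
  move: W1; rewrite W0; case: (W_cases 1) => [[_ W1] E|[[_ W1]|[_ [_ ->]]]].
  + by have := FK (window D 1); rewrite -W1 E => /ltm_nge[]; rewrite -addmA; apply: lem_addr.
  + rewrite W1 -addmA => /addmI E.
    by have := FK (fun k => D (1 + nm (d.-1 - k))); rewrite E => /ltm_nge[]; apply: lem_addr.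
  move=> /addmI/nm_inj E.
  pose b k := asb (D (nm k) < D (nm k + 1)).
  have asc0 : asc 0 = [seq b k | k <- iota 0 d.-1].
    by rewrite ascE; apply: eq_map => k; rewrite add0m.
  have asc1 : asc 1 = [seq b k | k <- iota 1 d.-1].
    rewrite ascE -[iota 1 _]/(iota (1 + 0) _) iotaDl -map_comp; apply: eq_map => k.
    by rewrite /b /= [1 + _]addmC.
  have d1E : d.-1 = d.-2.+1 by lia.
  have asc1' : asc 1 = rcons [seq b k | k <- iota 1 d.-2] (b d.-1).
    by rewrite asc1 {1}d1E -[d.-2.+1]addn1 iotaD map_cat cats1 add1n -d1E.
  move: nall0 has0 E; rewrite asc1' asc0 d1E => nall0 has0 /esym/eqP.
  exact/negP/run_code_shift/not_all_has.
Qed.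

End Sequence.

Lemma colorable_step : colorable d.+1 (K + K + nm extra) (nm 2 ^ n) (m + 1).
Proof.
exists stepF; split; first exact: dfun_stepF.
split; first exact: stepF_lt.
by move=> h Dh hn hS hom; apply: no_homogeneous Dh hn hS hom.
Qed.

End SteppingUp.

(** * Iterating the step and counting colors *)

Lemma colorable_mono d K K' n n' m : colorable d K n m -> K <= K' -> n' <= n ->
  colorable d K' n' m.
Proof.
move=> [F [DF [FK avF]]] KK' n'n; exists F; split=> //; split=> [e|h Dh hn].
  exact: ltm_lem_trans (FK e) KK'.
by apply: avF Dh _ => i im; apply: ltm_lem_trans (hn i im) n'n.
Qed.

(** The summand is absent at the first step, which starts from pairs. *)
Fixpoint colors (k i : nat) : nat :=
  if i is i'.+1 then ((colors k i').*2 + (if i' == 0 then 0 else 4))%N else k.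

Definition mtower (i : nat) x : M := iter i (fun y => nm 2 ^ y) x.

Lemma mtower_gt0 i x : 0 < x -> 0 < mtower i x.
Proof. by case: i => //= i _; apply/expm_gt0/nm2_gt0. Qed.

Lemma lem_mtower i x y : x <= y -> mtower i x <= mtower i y.
Proof. by move=> xy; elim: i => //= i IHi; apply: lem_exp2l IHi; apply: nm2_gt0. Qed.

Lemma nm2E : nm 2 = 1 + 1.
Proof. by rewrite /= add0m. Qed.

Lemma colorable_tower k i p c : nm 2 <= p -> 0 < nm k -> 0 < c ->
  colorable i.+2 (nm (colors k i) * c) (mtower i (p ^ (nm k * c))) (p + nm i).
Proof.
move=> p_ge2 k_gt0 c_gt0; have p_gt1 : 1 < p by apply/ltm_S; rewrite -nm2E.
have kc_gt0 : 0 < nm k * c by rewrite -(mul0m c); apply/ltm_pmul2r.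
elim: i => [|i IHi].
  by have := colorable_pairs kc_gt0 p_gt1; rewrite [nm 0]/= addm0.
have [F [DF [FK avF]]] := IHi.
have n_gt0 : 0 < mtower i (p ^ (nm k * c)).
  by apply/mtower_gt0/expm_gt0/ltm_trans/p_gt1/ltm01.
have dm : nm i.+2 <= p + nm i by rewrite (nmD 2 i); apply: lem_add p_ge2 (lem_refl _).
have := colorable_step (isT : 1 < i.+2)%N n_gt0 dm DF FK avF.
rewrite -[nm i.+1]/(nm i + 1) addmA => H; apply: colorable_mono H _ (lem_refl _).
rewrite [colors k i.+1]/= -addnn !nmD !mulmDl; apply: lem_add; first exact: lem_refl.
(* Since [c >= 1], the extra colors are absorbed into a multiple of [c]. *)
move: (if _ then _ else _) => x; have /(lem_mul (lem_refl (nm x))) := proj1 (ltm_S _ _) c_gt0.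
by rewrite add0m [_ * 1]mulmC mul1m.
Qed.

Lemma colors_le j : (colors j.+1 j <= 5 ^ j)%N.
Proof.
case: j => // j.
(* Adding 4 turns [K |-> 2K + 4] into doubling, starting from [2k + 4]. *)
have E k i : (colors k i.+1 + 4 = 2 ^ i.+1 * k + 4 * 2 ^ i)%N.
  elim: i => [|i IHi]; first by rewrite /= expn1; lia.
  rewrite -[colors k i.+2]/((colors k i.+1).*2 + 4)%N !expnS in IHi *; lia.
(* The left side is the closed form at [k = j + 2], the value that belongs to [j + 1] steps. *)
have le : (2 ^ j * (2 * j + 8) <= 5 ^ j.+1 + 4)%N.
  elim: j => // j IHj; rewrite [(2 ^ _)%N]expnS [(5 ^ _)%N]expnS.
  have : (0 < 2 ^ j)%N by rewrite expn_gt0.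
  move: IHj; set a := (2 ^ j)%N; set b := (5 ^ j.+1)%N; nia.
have := E j.+2 j; rewrite !expnS in le *; nia.
Qed.

(** Each further factor [p >= 2] at least doubles a positive number, hence adds at least 1. *)
Lemma base_growth p j : nm 2 <= p -> p + nm j <= p ^ nm j.+1.
Proof.
move=> p_ge2; elim: j => [|j IHj]; first by rewrite /= add0m expm1 addm0; apply: lem_refl.
have p_gt0 : 0 < p := ltm_lem_trans nm2_gt0 p_ge2.
rewrite -[nm j.+2]/(nm j.+1 + 1) expmS.
apply: lem_trans (lem_mul p_ge2 (lem_refl _)).
rewrite nm2E mulmDl mul1m /= addmA; apply: lem_add IHj _.
by rewrite -[x in x <= _]add0m; apply/ltm_S/expm_gt0.
Qed.

Lemma colorable_main j c m : 0 < c -> nm j.+2 <= m ->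
  colorable j.+2 (nm (5 ^ j) * c) (mtower j (m ^ c)) m.
Proof.
move=> c_gt0 /lemP[q mE]; have [p p_ge2 mp] : exists2 p, nm 2 <= p & m = p + nm j.
  (* The hypothesis [m >= d = j + 2] is exactly what leaves [p >= 2] after [j] elements are set
     aside. *)
  exists (nm 2 + q); first exact: lem_addr.
  by rewrite mE (nmD 2 j); ring.
have k_gt0 : 0 < nm j.+1 by apply/ltmS/lem0.
rewrite [X in colorable _ _ _ X]mp.
apply: colorable_mono (colorable_tower j p_ge2 k_gt0 c_gt0) _ _.
  by apply: lem_mul (lem_refl c); apply/lem_nm/colors_le.
by apply: lem_mtower; rewrite expmM mp; apply/lem_exp2r/base_growth.
Qed.

(** * Unfolding the formal statement *)

Implicit Types (e : nat -> M) (E : nat -> sets M).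

Lemma eval_num e k : eval e (num k) = nm k.
Proof. by elim: k => //= k ->. Qed.

Lemma eval_tower e i t : eval e (tower i t) = mtower i (eval e t).
Proof. by elim: i => //= i ->. Qed.

Lemma ecat_tail (X : Type) d (x : nat -> X) (y : X) (e : nat -> X) :
  ecat d x (y .: e) = ecat d.+1 (fun k => if (k < d)%N then x k else y) e.
Proof.
apply: functional_extensionality => k; rewrite /ecat ltnS.
case: (ltngtP k d) => // [dk|->]; last by rewrite subnn.
by rewrite -[(k - d)%N]prednK ?subn_gt0 // subnS.
Qed.

Lemma ecat_last (X : Type) d (x e : nat -> X) :
  ecat d.+1 x e = ecat d x (x d .: e).
Proof.
rewrite ecat_tail; apply: functional_extensionality => k; rewrite /ecat ltnS.
by case: (ltngtP k d) => // ->.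
Qed.

Lemma sat_Exs e E d A : sat e E (Exs d A) <-> exists x : nat -> M, sat (ecat d x e) E A.
Proof.
elim: d e => [|d IHd] e.
  by rewrite /=; split=> [H|[x]]; [exists e|]; rewrite ecat0.
rewrite -[Exs d.+1 A]/(Ex (Exs d A)) sat_ex; split=> [[y /IHd[x]]|[x]].
  by rewrite ecat_tail; eexists; eauto.
by rewrite ecat_last => H; exists (x d); apply/IHd; exists x.
Qed.

Lemma sat_Alls e E d A : sat e E (Alls d A) <-> forall x : nat -> M, sat (ecat d x e) E A.
Proof.
elim: d e => [|d IHd] e.
  by rewrite /=; split=> [H x|/(_ e)]; rewrite ecat0.
rewrite -[Alls d.+1 A]/(All (Alls d A)) sat_all; split=> [H x|H y].
  by rewrite ecat_last; apply: (proj1 (IHd _)).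
by apply/IHd => x; rewrite ecat_tail.
Qed.

Lemma sat_Conj_map e E (B : nat -> form) l :
  sat e E (Conj [seq B j | j <- l]) <-> forall j, j \in l -> sat e E (B j).
Proof.
elim: l => [|i l IHl]; first by split=> // _; apply.
rewrite -[Conj _]/(And (B i) (Conj [seq B j | j <- l])) sat_and IHl; split.
  by move=> [Bi Bl] j; rewrite inE => /orP[/eqP->|/Bl].
by move=> H; split=> [|j jl]; apply: H; rewrite inE ?eqxx ?jl ?orbT.
Qed.

(** * Codes of pairs and increasing tuples *)

Definition mpair x y : M := (x + y) * (x + y) + x.

Definition mtuple (xs : seq M) : M := if xs is x :: xs' then foldl mpair x xs' else 0.

Definition mtup (d : nat) (x : nat -> M) : M := mtuple [seq x k | k <- iota 0 d].

Lemma eval_ttuple e ts : eval e (ttuple ts) = mtuple (map (eval e) ts).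
Proof.
by case: ts => //= t ts; elim: ts t => //= t' ts IHts t.
Qed.

Lemma mtupS d (x : nat -> M) : mtup d.+2 x = mpair (mtup d.+1 x) (x d.+1).
Proof.
rewrite /mtup /mtuple -[d.+2]addn1 iotaD map_cat /= foldl_cat /=.
by rewrite add0n.
Qed.

(** The code lies between [(x + y) ^ 2] and the next square, so it determines the sum; then [x] and
    [y] follow by cancellation. *)
Lemma mpair_inj x y x' y' : mpair x y = mpair x' y' -> x = x' /\ y = y'.
Proof.
have mono u v u' v' : u + v < u' + v' -> mpair u v < mpair u' v'.
  move=> /ltmP[w E]; rewrite /mpair E; apply/ltmP.
  exists (u + v + v + (u + v) * w + w * (u + v) + w * w + w + w + u'); ring.
move=> E; have sE : x + y = x' + y'.
  by case: (ltm_total (x + y) (x' + y')) => [|[//|]] /mono; rewrite E => /ltmm.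
move: E; rewrite /mpair sE => /addmI xx; split=> //.
by apply: (@addmI x'); rewrite -sE xx.
Qed.

Lemma mtup_inj d (x y : nat -> M) : mtup d x = mtup d y -> forall k, (k < d)%N -> x k = y k.
Proof.
elim: d => // -[_ E [|//] _ //|d IHd].
rewrite !mtupS => /mpair_inj[/IHd E Ed] k; rewrite ltnS leq_eqVlt => /orP[/eqP-> //|].
exact: E.
Qed.

Lemma dfun_mpair n f g : dfun n f -> dfun n g -> dfun n (fun e => mpair (f e) (g e)).
Proof. by move=> Df Dg; dfun_tac. Qed.

Lemma dfun_mtup d n : (d <= n)%N -> dfun n (mtup d).
Proof.
elim: d => [|[_|d IHd]] dn; first exact: dfun_const.
  exact: (dfun_var dn).
have -> : mtup d.+2 = (fun e => mpair (mtup d.+1 e) (e d.+1)).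
  by apply: functional_extensionality => e; apply: mtupS.
by apply: dfun_mpair; [apply/IHd/ltnW | apply: dfun_var].
Qed.

Lemma definable_all_nat d n (P : nat -> (nat -> M) -> Prop) :
  (forall k, (k < d)%N -> definable n (P k)) ->
  definable n (fun e => forall k, (k < d)%N -> P k e).
Proof.
elim: d => [|d IHd] DP; first by apply: definable_ext (definable_const _ True).
apply: (@definable_ext _ (fun e => (forall k, (k < d)%N -> P k e) /\ P d e)) => [e|].
  split=> [[H Hd] k|H]; last by split=> [k kd|]; apply: H => //; apply: ltnW.
  by rewrite ltnS leq_eqVlt => /orP[/eqP->|/H].
by apply: definable_and; [apply: IHd => k kd; apply: DP; apply: ltnW | apply: DP].
Qed.

(** The common bound [r] on the entries keeps the block of quantifiers bounded, as comprehension for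
    the graph of a coloring requires. *)
Lemma definable_exists_tuple d n r (Q : (nat -> M) -> Prop) : definable (d + n) Q ->
  definable n (fun e => exists x : nat -> M,
    (forall k, (k < d)%N -> x k <= r) /\ Q (ecat d x e)).
Proof.
elim: d Q => [|d IHd] Q DQ.
  apply: definable_ext DQ => e; split=> [H|[x [_]]]; last by rewrite ecat0.
  by exists e; rewrite ecat0.
have DQ' : definable (d + n) (fun e => exists y, y <= r /\ Q (y .: e)).
  apply: (@definable_bex_le _ _ (fun e y => Q (y .: e))); first exact: dfun_const.
  by apply: definable_ext DQ => e; rewrite scons_eta.
apply: definable_ext (IHd _ DQ') => e; split.
  move=> [x [xr [y [yr H]]]]; exists (y .: x); split=> [[|k] //= /xr //|].
  by rewrite ecatS.
move=> [x [xr]]; rewrite ecatS => H; exists (fun k => x k.+1); split=> [k kd|].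
  exact: xr.
by exists (x 0%N); split=> //; apply: xr.
Qed.

Definition increasing (d : nat) r (x : nat -> M) : Prop :=
  (forall k, (k < d.-1)%N -> x k < x k.+1) /\ x d.-1 <= r.

Lemma increasing_le d r (x : nat -> M) k : increasing d r x -> (k < d)%N -> x k <= r.
Proof.
move=> [xS xr] kd; apply: lem_trans xr; have kd' : (k <= d.-1)%N by lia.
elim: {-3}(d.-1) kd' (leqnn d.-1) => [|j IHj].
  by rewrite leqn0 => /eqP-> _; apply: lem_refl.
rewrite leq_eqVlt ltnS => /orP[/eqP-> _|kj jd]; first exact: lem_refl.
exact: lem_trans (IHj kj (ltnW jd)) (ltmW (xS j jd)).
Qed.

Lemma sat_increasing_tuple e E d r a : (0 < d)%N ->
  sat e E (increasing_tuple d r a) <->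
  exists2 x : nat -> M, increasing d (eval e r) x & eval e a = mtup d x.
Proof.
move=> d_gt0; rewrite sat_Exs.
have tupE (x : nat -> M) : [seq eval (ecat d x e) i | i <- [seq $j | j <- iota 0 d]] =
              [seq x k | k <- iota 0 d].
  rewrite -map_comp; apply/eq_in_map => k; rewrite mem_iota add0n /= => kd.
  by rewrite /ecat kd.
have liftE (x : nat -> M) t : eval (ecat d x e) (tlift d t) = eval e t.
  rewrite eval_tlift; congr eval; apply: functional_extensionality => k.
  by rewrite /ecat ltnNge leq_addr addKn.
have xE (x : nat -> M) k : (k < d)%N -> ecat d x e k = x k by rewrite /ecat => ->.
split=> [[x]|[x [xS xr] aE]]; [|exists x]; rewrite !sat_and sat_Conj_map sat_le [sat _ _ (_ =' _)]/= /=;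
  rewrite eval_ttuple tupE !liftE xE; try lia.
  move=> [xS [xr aE]]; exists x => //; split=> // k kd.
  by have := xS k; rewrite mem_iota add0n /= !xE; try lia; apply.
split; last by split.
by move=> k; rewrite mem_iota add0n /= => kd; rewrite !xE; try lia; apply: xS.
Qed.

(** Bridges the two notions of object: comprehension turns the definable [F] into a set [C], and the
    set coding an enumeration is read back as a definable sequence, to which [avoids] applies. *)
Lemma colorable_refutes_weak_ramsey d n e E c m r : (1 < d)%N ->
  colorable d (eval e c) n (eval e m) -> eval e r < n ->
  ~ sat e E (weak_ramsey d c m r).
Proof.
move=> d_ge2 [F [DF [FK avF]]] rn; have d_gt0 : (0 < d)%N by apply: ltnW.
set R := eval e r in rn *.
pose graph z := exists x : nat -> M, increasing d R x /\ z = mpair (mtup d x) (F x).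
have [C HC] : exists C : sets M, forall z, imem z C <-> graph z.
  apply: comprehension.
  (* The tuple occupies places [0] to [d - 1]; its candidate code sits at place [d]. *)
  have DQ : definable (d + 1) (fun e => increasing d R e /\ e d = mpair (mtup d e) (F e)).
    have DFd : dfun (d + 1) F.
      by apply: (@dfun_rename d (d + 1) F id) DF => k kd; apply: ltn_addr.
    apply: definable_and; last first.
      apply: definable_eq; first by apply: dfun_var; rewrite addn1.
      by apply: dfun_mpair => //; apply: dfun_mtup; apply: leq_addr.
    apply: definable_and.
      by apply: definable_all_nat => k kd; apply: definable_lt; apply: dfun_var; lia.
    by apply: definable_le; [apply: dfun_var; lia | apply: dfun_const].
  apply: definable_ext (definable_exists_tuple R DQ) => e0.
  have depE (x : nat -> M) : increasing d R (ecat d x e0) /\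
      ecat d x e0 d = mpair (mtup d (ecat d x e0)) (F (ecat d x e0)) <->
      increasing d R x /\ e0 0%N = mpair (mtup d x) (F x).
    have xE k : (k < d)%N -> ecat d x e0 k = x k by rewrite /ecat => ->.
    have -> : ecat d x e0 d = e0 0%N by rewrite /ecat ltnn subnn.
    rewrite (dfun_depends (e' := x) DF xE).
    rewrite (dfun_depends (e' := x) (dfun_mtup (leqnn d)) xE).
    suff -> : increasing d R (ecat d x e0) <-> increasing d R x by [].
    rewrite /increasing xE; last by lia.
    by split=> -[H xr]; split=> // k kd; have := H k kd; rewrite !xE //; lia.
  split=> [[x [_ /depE]]|[x Hx]]; first by exists x.
  exists x; split; last exact/depE.
  by move=> k; apply: increasing_le; case: Hx.
have colC : sat e (C .: E) (coloring 0 d r c).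
  rewrite /coloring /is_function sat_and !sat_all; split=> a.
    rewrite sat_imp => /HC[x [xi aE]]; rewrite sat_ex; exists (mtup d x).
    rewrite sat_ex; exists (F x); rewrite !sat_and sat_increasing_tuple //.
    split; first by exists x => //; rewrite /= eval_tlift.
    by split; rewrite /= ?eval_tlift //; apply: FK.
  rewrite sat_imp sat_increasing_tuple // eval_tlift1 -/R => -[x xi aE].
  rewrite /= in aE; rewrite sat_ex; exists (F x); rewrite !sat_and.
  split; first by rewrite /= eval_tlift; apply: FK.
  split; first by apply/HC; exists x; rewrite -aE.
  rewrite sat_all => v; rewrite sat_imp sat_and => -[_ /HC[y [yi]]].
  rewrite /= aE => /mpair_inj[xy ->].
  exact: dfun_depends DF (mtup_inj (esym xy)).
rewrite /weak_ramsey sat_allS => /(_ C); rewrite sat_imp => /(_ colC).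
rewrite sat_exS => -[H]; rewrite sat_exS => -[hs]; rewrite !sat_and.
move=> [HR [[[_ hfun] [hmono _]] hom]].
(* Beyond [m] the search may fail and return 0, which keeps [h] total and below [R + 1]. *)
pose h i := mu (R + 1) (fun x => imem (mpair i x) hs).
have Dmem i : definable 1 (fun e0 => imem (mpair i (e0 0%N)) hs).
  by apply: definable_mem; apply: dfun_mpair; dfun_tac.
have Dh : dseq h.
  split; last by exists (R + 1) => x; apply: mu_le.
  apply: (@dfun_mu 1 (fun _ => R + 1) (fun e0 x => imem (mpair (e0 0%N) x) hs)).
    exact: dfun_const.
  by apply: definable_mem; apply: dfun_mpair; dfun_tac.
have hi i : i <= eval e m -> imem (mpair i (h i)) hs.
  move=> im; move: hfun; rewrite sat_all => /(_ i).
  rewrite sat_imp sat_le eval_tlift1 => /(_ im)/sat_ex[x].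
  rewrite !sat_and => -[xH [ix _]].
  have xR : x < R + 1.
    apply/ltmS; move: HR; rewrite sat_all => /(_ x); rewrite sat_imp sat_le eval_tlift.
    exact.
  by have [_ []] := mu_prop (P := fun x => imem (mpair i x) hs) (Dmem i) xR ix.
apply: (avF h Dh).
- move=> i _; apply: (@ltm_lem_trans (R + 1)); last exact/ltm_S.
  by apply: mu_lt => //; apply/ltmS/lem0.
- move=> i im; have := hmono; rewrite !sat_all.
  move=> /(_ i); rewrite sat_all => /(_ (i + 1)); rewrite sat_all => /(_ (h i)).
  rewrite sat_all => /(_ (h (i + 1))); rewrite sat_imp !sat_and; apply.
  by split; [apply/hi/ltmW | split; [apply/hi/ltm_S | apply: ltmm1]].
move=> i im; move: hom; rewrite sat_all => /(_ i); rewrite sat_Alls.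
move=> /(_ (fun k => h (i + nm k))); rewrite sat_imp sat_Conj_map.
set e1 := ecat _ _ _.
have e1E k : (k < d.+1)%N -> e1 k = h (i + nm k) by rewrite /e1 /ecat => ->.
have e1i : e1 d.+1 = i by rewrite /e1 /ecat ltnn subnn.
have prem (k : nat) : k \in iota 0 d.+1 ->
    sat e1 (hs .: H .: C .: E) (tpair ($d.+1 +' num k) $k \in' 0).
  rewrite mem_iota add0n /= => kd; rewrite e1i eval_num e1E //.
  apply: hi; apply: lem_trans im; apply: lem_add (lem_refl _) _.
  by apply: lem_nm; rewrite -ltnS.
move=> /(_ prem)/sat_ex[v]; rewrite sat_and.
have tup0 : eval (v .: e1) (ttuple [seq $j.+1 | j <- iota 0 d]) = mtup d (window h i).
  rewrite eval_ttuple -map_comp; congr mtuple; apply/eq_in_map => k.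
  by rewrite mem_iota add0n /= => kd; rewrite e1E // ltnW.
have tup1 : eval (v .: e1) (ttuple [seq $j.+1 | j <- iota 1 d]) = mtup d (window h (i + 1)).
  rewrite eval_ttuple -map_comp -[iota 1 d]/(iota (1 + 0) d) iotaDl -map_comp.
  congr mtuple; apply/eq_in_map => k; rewrite mem_iota add0n /= => kd.
  by rewrite /window add1n e1E // -addmA [1 + _]addmC.
have graphE (x : nat -> M) a : graph (mpair (mtup d x) a) -> a = F x.
  by move=> [y [_ /mpair_inj[xy ->]]]; apply: dfun_depends DF (mtup_inj (esym xy)).
by move=> [/HC + /HC]; rewrite /= tup0 tup1 => /graphE <- /graphE <-.
Qed.

End Model.

Theorem theorem17 (d : nat) (hd : 2 <= d) :
  proves RCA0star
    (All (All (One <=' $1 /\' num d <=' $0 ->'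
       wr_ge d (num (5 ^ (d - 2)) *' $1) $0 (tower (d - 2) ($0 ^^' $1))))).
Proof.
apply: completeness => M modelM e E; have setsM : inhabited (sets M) by exists; exact: E 0.
rewrite !sat_all => c; rewrite sat_all => m.
rewrite sat_imp sat_and !sat_le eval_num => -[c_ge1 dm].
rewrite /wr_ge sat_all => r; rewrite sat_imp sat_le eval_tlift1 eval_tower => wr.
(* An [r] below the tower is still in the range where the coloring exists, so the Ramsey property
   fails at [r]. *)
apply/(lem_ngt modelM setsM) => rn; move: wr.
have c_gt0 : (0 < c)%M.
  by apply/(ltm_S modelM setsM); rewrite (add0m modelM setsM).
have dE : d = (d - 2).+2 by rewrite -addn2 subnK.
rewrite dE in dm.
have col := colorable_main modelM setsM c_gt0 dm; rewrite -dE in col.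
apply: (colorable_refutes_weak_ramsey modelM setsM hd _ rn).
by rewrite !eval_tlift1 /= eval_num.
Qed.
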